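(* Feedback Vertex Set (given a graph $G$ on $n$ vertices and $k\in\mathbb{N}$, decide whether there is $S\subseteq V(G)$ with $|S|\le k$ such that $G-S$ is a forest) can be solved using $O(k\log n)$ bits of auxiliary space and in time $5^k\cdot n^{O(1)}$.
   Context: Space model: the input is in read-only random-access memory, output is written to a write-only stream, and only auxiliary read-write memory is counted; words have $O(\log n)$ bits. *)

(* Defs.v *)
From mathcomp Require Import all_boot.
Set Implicit Arguments.
Unset Strict Implicit.
Unset Printing Implicit Defensive.

Inductive binop := Add | Sub | Mul | Div | Mod | Eq | Lt.

(* [Sub] truncates at 0 and division by 0 gives quotient 0, as in ssrnat/div. *)
Definition binop_val (o : binop) (x y : nat) : nat :=
  match o with
  | Add => x + y
  | Sub => x - y
  | Mul => x * y
  | Div => x %/ y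
  | Mod => x %% y
  | Eq => x == y
  | Lt => x < y
  end.

(* Below, M is the auxiliary memory, and i, j, l are fixed addresses in it.
   There are no further registers: all read-write storage is in M. *)
Inductive cmd :=
  | Skip
  | Const (i v : nat)               (* M[i] := v *)
  | Bin (o : binop) (i j l : nat)   (* M[i] := M[j] o M[l] *)
  | LoadInd (i j : nat)             (* M[i] := M[M[j]] *)
  | StoreInd (i j : nat)            (* M[M[i]] := M[j] *)
  | Read (i j : nat)                (* M[i] := input[M[j]] *)
  | Write (i : nat)                 (* append M[i] to the output *)
  | Seq (c1 c2 : cmd)
  | If (i : nat) (c1 c2 : cmd)      (* M[i] <> 0 is true *)
  | While (i : nat) (c : cmd).

Definition mem := nat -> nat.

Definition upd (m : mem) (i v : nat) : mem :=
  fun j => if j == i then v else m j.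

(* [exec w s inp c m m' out t]: on a machine with w-bit words and s words of
   auxiliary memory, with read-only input inp, the command c started in memory
   m halts after t steps in memory m', having written the stream out.  Every
   stored value is reduced modulo 2 ^ w.  No rule applies to an access to an
   address >= s, so that a derivation exists only if c halts within s words.
   Input cells past the end of inp read as 0. *)
Inductive exec (w s : nat) (inp : seq nat) :
    cmd -> mem -> mem -> seq nat -> nat -> Prop :=
  | ExecSkip m :
      exec w s inp Skip m m [::] 1
  | ExecConst i v m :
      i < s ->
      exec w s inp (Const i v) m (upd m i (v %% 2 ^ w)) [::] 1
  | ExecBin o i j l m :
      i < s -> j < s -> l < s ->
      exec w s inp (Bin o i j l) m
        (upd m i (binop_val o (m j) (m l) %% 2 ^ w)) [::] 1
  | ExecLoadInd i j m :
      i < s -> j < s -> m j < s ->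
      exec w s inp (LoadInd i j) m (upd m i (m (m j))) [::] 1
  | ExecStoreInd i j m :
      i < s -> j < s -> m i < s ->
      exec w s inp (StoreInd i j) m (upd m (m i) (m j)) [::] 1
  | ExecRead i j m :
      i < s -> j < s ->
      exec w s inp (Read i j) m (upd m i (nth 0 inp (m j) %% 2 ^ w)) [::] 1
  | ExecWrite i m :
      i < s ->
      exec w s inp (Write i) m m [:: m i] 1
  | ExecSeq c1 c2 m m1 m2 out1 out2 t1 t2 :
      exec w s inp c1 m m1 out1 t1 ->
      exec w s inp c2 m1 m2 out2 t2 ->
      exec w s inp (Seq c1 c2) m m2 (out1 ++ out2) (t1 + t2)
  | ExecIf i c1 c2 m m' out t :
      i < s ->
      exec w s inp (if m i != 0 then c1 else c2) m m' out t ->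
      exec w s inp (If i c1 c2) m m' out t.+1
  | ExecWhileStop i c m :
      i < s -> m i = 0 ->
      exec w s inp (While i c) m m [::] 1
  | ExecWhileLoop i c m m1 m2 out1 out2 t1 t2 :
      i < s -> m i != 0 ->
      exec w s inp c m m1 out1 t1 ->
      exec w s inp (While i c) m1 m2 out2 t2 ->
      exec w s inp (While i c) m m2 (out1 ++ out2) (t1 + t2).+1.

(* The auxiliary memory is initially all zero. *)
Definition runs (w s : nat) (c : cmd) (inp out : seq nat) (t : nat) : Prop :=
  exists m' : mem, exec w s inp c (fun=> 0) m' out t.

(* A simple graph is a symmetric irreflexive relation; its cycles are the
   duplicate-free cyclic sequences of at least three vertices. *)
Definition forest (T : eqType) (e : rel T) : Prop :=
  ~ exists c : seq T, ucycle e c /\ 3 <= size c.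

(* G - S, on the vertex type {v | v \notin S}. *)
Definition del_vertices (T : finType) (e : rel T) (S : {set T}) :
    rel {v : T | v \notin S} :=
  fun u v => e (val u) (val v).

Definition feedback_vertex_set (T : finType) (e : rel T) (k : nat) : Prop :=
  exists S : {set T}, #|S| <= k /\ forest (@del_vertices T e S).

(* Binary digits of k, least significant first, without leading zeros. *)
Definition digits (k : nat) : seq nat :=
  mkseq (fun i => k %/ 2 ^ i %% 2) (up_log 2 k.+1).

(* The number n of vertices, the n * n adjacency matrix in row-major order,
   then k in binary, closed by the end marker 2.  The parameter k is not given
   as one word because it is unbounded while words have O(log n) bits. *)
Definition encode (n : nat) (e : rel 'I_n) (k : nat) : seq nat :=
  n :: [seq nat_of_bool (e u v) | u <- enum 'I_n, v <- enum 'I_n]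
    ++ rcons (digits k) 2.

(* log n, kept positive for n < 2. *)
Definition log2 (n : nat) : nat := trunc_log 2 (maxn 2 n).

(* Main.v *)
Require Import Defs.
From mathcomp Require Import all_boot zify.
Set Implicit Arguments.
Unset Strict Implicit.
Unset Printing Implicit Defensive.

(** Iterative compression: the vertices are added one by one, and [W] consists of
    a solution for the previous graph and the new vertex, so that [F = V \ W]
    induces a forest and [#|W| <= k + 1].  The vertices of [F] are processed in an
    order in which each of them has at most one unprocessed neighbour.  When [v] is
    reached, let [Z] be the set of kept vertices of [W] and of kept processed
    vertices.  If at most one neighbour of [v] lies in a component of [G[Z]] that
    meets [W], then [v] is kept: a solution containing [v] can be modified to
    contain its unprocessed neighbour instead.  Otherwise one guesses whether [v]
    is deleted; a deletion uses up one unit of the budget, and keeping [v] merges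
    two components that meet [W].  Hence a solution that deletes [z] vertices of
    [W] is found with fewer than [2 (k + 1 - z)] guessed bits.  One digit in
    [{0 .. 4}] for each vertex of [W] therefore suffices: 0 deletes the vertex, and
    the four other values keep it and supply two bits.  This gives [5 ^ (k + 1)]
    strings of digits, and each is tried in polynomial time.

    Connectivity in a forest needs no marks: the walk that leaves each vertex
    through the cyclic successor of the edge by which it came traverses a whole
    component.  The order on [F] is the reverse of the order of first visits of
    such walks.  So only [W], the digits, the bits and the deleted vertices are
    stored, that is, [O(k)] words. *)

(** * Connectivity and cycles in induced subgraphs *)

Section InducedSubgraph.
Variables (T : finType) (e : rel T).
Hypothesis e_sym : symmetric e.
Implicit Types (W Z A B : {set T}) (c p : seq T).

Definition induced Z : rel T := fun x y => [&& e x y, x \in Z & y \in Z].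
Definition conn Z : rel T := connect (induced Z).
Definition acyclic Z : Prop :=
  forall c, ucycle e c -> 2 < size c -> ~~ all (mem Z) c.

Lemma conn_sym Z : symmetric (conn Z).
Proof.
by apply: sym_connect_sym => x y; rewrite /induced e_sym; congr andb; rewrite andbC.
Qed.

Lemma conn_refl Z x : conn Z x x. Proof. exact: connect0. Qed.

Lemma conn_trans Z x y z : conn Z x y -> conn Z y z -> conn Z x z.
Proof. exact: connect_trans. Qed.

Lemma conn_sub A B x y : A \subset B -> conn A x y -> conn B x y.
Proof.
move=> /subsetP sAB; apply: connect_sub => u v /and3P[euv uA vA].
by apply: connect1; rewrite /induced euv !sAB.
Qed.

Lemma conn_edge Z x y : e x y -> x \in Z -> y \in Z -> conn Z x y.
Proof. by move=> exy xZ yZ; apply: connect1; rewrite /induced exy xZ. Qed.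

Lemma conn_ind Z (P : pred T) x y :
  (forall u v, P u -> u \in Z -> v \in Z -> e u v -> P v) ->
  P x -> conn Z x y -> P y.
Proof.
move=> stepP Px /connectP[p]; elim: p x Px => [|u p IHp] x Px /=; first by move=> _ ->.
by move=> /andP[/and3P[exu xZ uZ] pth] yE; apply: (IHp u) => //; apply: (stepP x).
Qed.

Lemma conn_mem Z x y : x \in Z -> conn Z x y -> y \in Z.
Proof. by move=> xZ; apply: (conn_ind (P := [in Z])). Qed.

Lemma path_induced Z x p :
  x \in Z -> path (induced Z) x p = path e x p && all (mem Z) p.
Proof.
elim: p x => //= u p IHp x xZ; rewrite /induced xZ /=.
by have [/IHp ->|_] := boolP (u \in Z); rewrite ?andbF ?andbT ?andbA.
Qed.

Lemma conn_upath Z x y : x \in Z -> conn Z x y ->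
  exists p, [/\ path e x p, last x p = y, uniq (x :: p) & all (mem Z) (x :: p)].
Proof.
move=> xZ /connectP[p0 pth0 ->]; case/shortenP: pth0 => p.
by rewrite path_induced // => /andP[pth pZ] up _; exists p; split; rewrite //= xZ.
Qed.

Lemma acyclic_sub A B : A \subset B -> acyclic B -> acyclic A.
Proof.
move=> /subsetP sAB acB c uc sc; apply: contra (acB c uc sc) => /allP cA.
by apply/allP => x /cA; apply: sAB.
Qed.

Lemma acyclic0 : acyclic set0.
Proof. by move=> [|x c] // _ _; rewrite /= inE. Qed.

Lemma acyclic_link_unique Z A B a a' b b' :
  acyclic Z -> A \subset Z -> B \subset Z -> [disjoint A & B] ->
  a \in A -> b \in B -> conn A a a' -> conn B b b' ->
  e a b -> e a' b' -> a = a' /\ b = b'.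
Proof.
move=> acZ /subsetP sAZ /subsetP sBZ dAB aA bB caa' cbb' eab eab'.
have b'B := conn_mem bB cbb'; rewrite conn_sym in cbb'.
have [p [pthp lp up Ap]] := conn_upath aA caa'.
have [q [pthq lq uq Bq]] := conn_upath b'B cbb'.
have [sz|] := ltnP 2 (size ((a :: p) ++ (b' :: q))); last first.
  case: p lp {pthp up Ap} => [|x p] /= lp; last by rewrite size_cat /= addnS.
  by case: q lq {pthq uq Bq} => [|x q].
have uc : ucycle e ((a :: p) ++ b' :: q).
  apply/andP; split.
    by rewrite cat_cons /= rcons_cat cat_path pthp lp /= eab' rcons_path pthq lq e_sym.
  rewrite cat_uniq up uq andbT; apply/hasPn => x xq; apply/negP => xp.
  by have /pred0P/(_ x)/= := dAB; move: (allP Ap x xp) (allP Bq x xq) => /= -> ->.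
have := acZ _ uc sz; rewrite all_cat.
by rewrite (sub_all (a2 := mem Z) sAZ Ap) (sub_all (a2 := mem Z) sBZ Bq).
Qed.

Lemma ucycle_nbrs Z v c : ucycle e c -> 2 < size c -> v \in c -> all (mem (v |: Z)) c ->
  exists u u', [/\ u != u', e v u, e v u', u \in Z & conn Z u u'].
Proof.
move=> /andP[cyc uc] sz vc cZ; have [i p rc] := rot_to vc.
move: cyc uc sz cZ; rewrite -(rot_cycle i) -(rot_uniq i) -(size_rot i).
rewrite -(perm_all _ (permEl (perm_rot i c))) rc.
case: p {rc} => // u p /=; rewrite rcons_path => /and3P[evu pth elv].
case/and3P=> vp up _ sp /and3P[_ uZ pZ].
have inZ x : x \in u :: p -> (mem (v |: Z)) x -> x \in Z.
  by move=> xp; rewrite inE in_setU1; case: eqP xp vp => // -> ->.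
have {}uZ : u \in Z by apply: inZ; rewrite ?mem_head.
have {}pZ : all (mem Z) p.
  by apply/allP => x xp; apply: inZ; [rewrite inE xp orbT | apply: (allP pZ)].
exists u, (last u p); split=> //; last 2 first.
- by rewrite e_sym.
- by apply/connectP; exists p; rewrite // path_induced // pth.
case: p sp up {pth elv inZ vp pZ} => //= y p _.
by apply: contra => /eqP ->; apply: mem_last.
Qed.

Lemma acyclic_add Z v : acyclic Z ->
  (forall u u', u \in Z -> e v u -> e v u' -> conn Z u u' -> u = u') ->
  acyclic (v |: Z).
Proof.
move=> acZ uniq_nbr c uc sc; apply/negP => cvZ.
have [vc|vc] := boolP (v \in c).
  have [u [u' [/eqP nuu' evu evu' uZ cuu']]] := ucycle_nbrs uc sc vc cvZ.
  exact: nuu' (uniq_nbr u u' uZ evu evu' cuu').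
case/negP: (acZ c uc sc); apply/allP => x xc.
by have := allP cvZ x xc; rewrite !inE; case: eqP xc vc => // -> ->.
Qed.

Lemma acyclic_nbr_unique Z v u u' : v \notin Z -> acyclic (v |: Z) ->
  u \in Z -> e v u -> e v u' -> conn Z u u' -> u = u'.
Proof.
rewrite ![e v _]e_sym => vZ acZ uZ evu evu' cuu'.
have [|||||//] := acyclic_link_unique (A := Z) (B := [set v]) acZ _ _ _ uZ _ cuu' _ evu evu'.
- exact: subsetUr.
- exact: subsetUl.
- by rewrite disjoint_sym disjoints1.
- by rewrite inE.
- exact: conn_refl.
Qed.

Lemma forest_del_vertices (S : {set T}) : forest (@del_vertices T e S) <-> acyclic (~: S).
Proof.
have ucycle_val (c : seq {v | v \notin S}) :
    ucycle (@del_vertices T e S) c = ucycle e (map val c).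
  by rewrite /ucycle cycle_map map_inj_uniq //; apply: val_inj.
split=> [forS c uc sc|acS [c [uc sc]]].
  apply/negP => /allP cS; apply: forS.
  have [c' cE] : exists c' : seq {v | v \notin S}, map val c' = c.
    elim: c cS {uc sc} => [|x c IHc] cS; first by exists [::].
    have [|c' <-] := IHc; first by move=> y yc; apply: cS; rewrite inE yc orbT.
    have xS : x \notin S by have := cS x (mem_head _ _); rewrite !inE.
    by exists (exist _ x xS :: c').
  by exists c'; rewrite ucycle_val -(size_map val) cE.
rewrite ucycle_val in uc; rewrite -(size_map val) in sc.
case/negP: (acS _ uc sc); apply/allP => _ /mapP[x _ ->].
by rewrite !inE; apply: (valP x).
Qed.

Definition component Z x : {set T} := [set y | conn Z x y].
Definition ncomp (W Z : {set T}) : nat := #|[set component Z w | w in W :&: Z]|.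

Lemma eq_component Z x y : conn Z x y -> component Z x = component Z y.
Proof.
move=> cxy; apply/setP => z; rewrite !inE; apply/idP/idP; last exact: conn_trans.
by apply: conn_trans; rewrite conn_sym.
Qed.

Lemma ncomp_le_card W Z : ncomp W Z <= #|W :&: Z|.
Proof. exact: leq_imset_card. Qed.

Definition component_closure Z (C : {set T}) : {set T} := \bigcup_(x in C) component Z x.

Lemma component_closureE A B x :
  A \subset B -> component_closure B (component A x) = component B x.
Proof.
move=> sAB; apply/setP => y; apply/bigcupP/idP => [[z]|cxy].
  by rewrite !inE => /(conn_sub sAB); apply: conn_trans.
by exists x; rewrite // inE conn_refl.
Qed.

Lemma components_add W Z v : v \notin W ->
  [set component (v |: Z) w | w in W :&: (v |: Z)] =
  component_closure (v |: Z) @: [set component Z w | w in W :&: Z].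
Proof.
move=> vW; rewrite -imset_comp.
have -> : W :&: (v |: Z) = W :&: Z.
  by apply/setP => x; rewrite !inE; case: eqP => // ->; rewrite (negPf vW).
by apply: eq_imset => w /=; rewrite component_closureE ?subsetUr.
Qed.

Lemma ncomp_add W Z v : v \notin W -> ncomp W (v |: Z) <= ncomp W Z.
Proof. by move=> vW; rewrite /ncomp components_add ?leq_imset_card. Qed.

Lemma ncomp_add_lt W Z v u u' w w' : v \notin W -> v \notin Z -> acyclic (v |: Z) ->
  u != u' -> e v u -> e v u' -> u \in Z -> u' \in Z ->
  w \in W -> w' \in W -> conn Z u w -> conn Z u' w' ->
  ncomp W (v |: Z) < ncomp W Z.
Proof.
move=> vW vZ acZ /eqP nuu' evu evu' uZ u'Z wW w'W cuw cu'w'.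
have svZ : Z \subset v |: Z by apply: subsetUr.
have root_comp y x : e v y -> y \in Z -> conn Z y x ->
    component (v |: Z) x = component (v |: Z) v.
  move=> evy yZ cyx; apply/esym/eq_component; apply: conn_trans (conn_sub svZ cyx).
  by apply: conn_edge; rewrite ?in_setU1 ?eqxx ?yZ ?orbT.
rewrite ltn_neqAle ncomp_add // andbT /ncomp components_add //.
apply/negP => /imset_injP inj_closure; apply: nuu'.
apply: (acyclic_nbr_unique vZ acZ uZ evu evu').
apply: (conn_trans cuw); rewrite conn_sym; apply: (conn_trans cu'w').
suff /setP/(_ w) : component Z w' = component Z w by rewrite !inE conn_refl.
have [wZ w'Z] := (conn_mem uZ cuw, conn_mem u'Z cu'w').
apply: inj_closure; try by apply: imset_f; rewrite inE ?wW ?w'W ?wZ ?w'Z.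
by rewrite !component_closureE // (root_comp u' w') // (root_comp u w).
Qed.

End InducedSubgraph.

(** * Extending a partial solution *)

Section Extension.
Variables (T : finType) (e : rel T).
Hypothesis e_sym : symmetric e.
Local Notation conn := (conn e).
Local Notation acyclic := (acyclic e).
Implicit Types (D F S U Z : {set T}) (u v : T).

Definition convex F U : Prop := {in U &, forall x y, conn F x y -> conn U x y}.

Definition reaches Z (P : pred T) u : bool := [exists x, conn Z u x && P x].

Variables V W : {set T}.
Local Notation F := (V :\: W).
Hypothesis acF : acyclic F.

Definition live D U : {set T} := V :\: D :\: U.

Definition extendable D U m : Prop :=
  exists S, [/\ D \subset S, S :\: D \subset U, #|S :\: D| <= m & acyclic (V :\: S)].

Lemma extendable0 D m : extendable D set0 m -> acyclic (V :\: D).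
Proof.
case=> S [sDS]; rewrite subset0 setD_eq0 => sSD _.
by congr (acyclic (V :\: _)); apply/eqP; rewrite eqEsubset sSD.
Qed.

Lemma live_add D U v : v \in V -> v \notin D -> v \notin U ->
  live D U = v |: live D (v |: U).
Proof.
move=> vV vD vU; apply/setP => x; rewrite !inE.
by case: eqP => //= ->; rewrite vV vD vU.
Qed.

Lemma card_nbrs_convex U v : v \in F -> v \notin U -> U \subset F -> convex F U ->
  #|[set p in U | e v p]| <= 1.
Proof.
move=> vF vU sUF cvU; apply/card_le1_eqP => p q /setIdP[pU evp] /setIdP[qU evq].
have inF x : x \in U -> x \in F by apply: (subsetP sUF).
have cpq : conn F q p.
  apply: (@conn_trans _ _ F _ v); last exact: conn_edge evp _ (inF p pU).
  by rewrite conn_sym //; apply: conn_edge (inF q qU).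
apply: (acyclic_nbr_unique e_sym vU _ qU evq evp (cvU _ _ qU pU cpq)).
by apply: acyclic_sub acF; rewrite subUset sub1set vF.
Qed.

Section Exchange.
Variables (D U S : {set T}) (v : T).
Hypotheses (vF : v \in F) (sUF : v |: U \subset F) (cvU : convex F (v |: U)).
Hypotheses (sDS : D \subset S) (vS : v \in S).
Local Notation Z := (live D (v |: U)).
Local Notation nbrs := [set p in U | e v p].
Local Notation rooted := (reaches Z [in W]).
Local Notation kept := (V :\: (S :|: nbrs)).

Lemma mem_live_kept_nbr u : u \in kept -> e v u -> u \in Z.
Proof.
rewrite !inE negb_or => /andP[/andP[uS uN] uV] evu; rewrite uV andbT negb_or.
have -> : u \notin D by apply: contra uS; apply: (subsetP sDS).
have -> : u \notin U by apply: contra uN => ->.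
by rewrite !andbT; apply: contraNneq uS => ->.
Qed.

Lemma unrooted_forest u x : ~~ rooted u -> x \in Z -> conn Z u x -> x \in F.
Proof.
move=> unr xZ cux; rewrite in_setD; apply/andP; split.
  by apply: contra unr => xW; apply/existsP; exists x; rewrite cux.
by move: xZ; rewrite !in_setD => /andP[_ /andP[]].
Qed.

Lemma kept_unrooted_forest u : ~~ rooted u -> u \in kept -> e v u -> u \in Z :&: F.
Proof.
move=> unr uK evu; have uZ := mem_live_kept_nbr uK evu.
by rewrite in_setI uZ (unrooted_forest unr) ?conn_refl.
Qed.

Lemma conn_kept_unrooted u u' :
  ~~ rooted u -> u \in kept -> e v u -> conn kept u u' -> conn (Z :&: F) u u'.
Proof.
move=> unr uK evu cuu'; have uZF := kept_unrooted_forest unr uK evu.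
apply: (conn_ind (P := conn (Z :&: F) u) _ _ cuu'); last exact: conn_refl.
move=> y y' cuy yK y'K eyy'; have yZF := conn_mem uZF cuy.
have yZ : y \in Z by case/setIP: yZF.
have [y'Z|y'Z] := boolP (y' \in Z).
  apply: (conn_trans cuy); apply: conn_edge; rewrite // in_setI y'Z (unrooted_forest unr) //.
  by apply: conn_trans (conn_sub (subsetIl _ _) cuy) _; apply: conn_edge.
have [y'S y'V] : y' \notin S /\ y' \in V.
  by move: y'K; rewrite !inE negb_or => /andP[/andP[]].
have y'U : y' \in v |: U.
  apply: contraNT y'Z => y'U; rewrite 2!in_setD y'U y'V andbT /=.
  by apply: contra y'S; apply: (subsetP sDS).
have vU : v \in v |: U by rewrite setU11.
have [uF yF y'F] : [/\ u \in F, y \in F & y' \in F].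
  by case/setIP: uZF; case/setIP: yZF => *; split=> //; apply: (subsetP sUF).
have cvy' : conn (v |: U) v y'.
  apply: cvU => //; apply: (conn_trans (conn_edge evu vF uF)).
  by apply: (conn_trans (conn_sub (subsetIr _ _) cuy)); apply: conn_edge.
have dis : [disjoint Z :&: F & v |: U].
  by apply/pred0P => x; rewrite /= in_setI [x \in Z]in_setD; case: (x \in v |: U); rewrite ?andbF.
rewrite e_sym in evu.
have [_ vy'] := acyclic_link_unique e_sym acF (subsetIr _ _) sUF dis uZF vU cuy cvy' evu eyy'.
by rewrite -vy' vS in y'S.
Qed.

Lemma exchange_acyclic : acyclic (V :\: S) ->
  (forall u u', e v u -> e v u' -> u \in Z -> u' \in Z -> rooted u -> rooted u' -> u = u') ->
  acyclic (V :\: ((S :\ v) :|: nbrs)).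
Proof.
move=> acS uniq_rooted.
have sub : V :\: ((S :\ v) :|: nbrs) \subset v |: kept.
  by apply/subsetP => x; rewrite !inE; case: eqP.
apply: acyclic_sub sub (acyclic_add e_sym _ _).
  by apply: acyclic_sub acS; apply/setDS/subsetUl.
have unrooted_unique u u' : ~~ rooted u -> u \in kept -> e v u -> e v u' ->
    conn kept u u' -> u = u'.
  move=> unr uK evu evu' cuu'; have cZF := conn_kept_unrooted unr uK evu cuu'.
  apply: (acyclic_nbr_unique e_sym _ _ (kept_unrooted_forest unr uK evu) evu evu' cZF).
  - by rewrite !inE eqxx.
  - by apply: acyclic_sub acF; rewrite subUset sub1set vF subsetIr.
move=> u u' uK evu evu' cuu'; have u'K := conn_mem uK cuu'.
have [ru|] := boolP (rooted u); last by move/unrooted_unique; apply.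
have [ru'|/unrooted_unique] := boolP (rooted u'); last first.
  by move=> unr; apply/esym/unr; rewrite // conn_sym.
by apply: uniq_rooted; rewrite ?mem_live_kept_nbr.
Qed.

End Exchange.

Section Processing.
Variables (D U : {set T}) (v : T) (m : nat).
Hypotheses (sUF : v |: U \subset F) (vU : v \notin U) (vD : v \notin D).
Hypotheses (cvU : convex F U) (cvUv : convex F (v |: U)).
Local Notation Z := (live D (v |: U)).
Local Notation rooted_nbrs := [pred u | [&& e v u, u \in Z & reaches Z [in W] u]].

Let vF : v \in F. Proof. by apply: (subsetP sUF); rewrite setU11. Qed.

Lemma extendable_keep S : D \subset S -> S :\: D \subset v |: U -> #|S :\: D| <= m ->
  acyclic (V :\: S) -> v \notin S -> extendable D U m.
Proof.
move=> sDS sSU cS acS vS; exists S; split=> //; apply/subsetP => x xS.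
have := subsetP sSU x xS; rewrite in_setU1; case/orP=> // /eqP xv.
by move: xS; rewrite xv in_setD (negPf vS) andbF.
Qed.

(* A solution that deletes [v] is changed to delete the unprocessed neighbour of
   [v] instead. *)
Lemma extendable_forced : #|rooted_nbrs| <= 1 -> extendable D (v |: U) m -> extendable D U m.
Proof.
move=> few [S [sDS sSU cS acS]].
have [vS|vS] := boolP (v \in S); last exact: extendable_keep sDS sSU cS acS vS.
set P := [set p in U | e v p].
exists ((S :\ v) :|: P); split.
- by apply: subset_trans (subsetUl _ _); apply/subsetD1P.
- apply/subsetP => x; rewrite !inE => /andP[xD /orP[/andP[xv xS]|/andP[]//]].
  by have := subsetP sSU x; rewrite !inE xD xS (negPf xv); apply.
- apply: leq_trans cS; rewrite (cardsD1 v (S :\: D)) in_setD vS vD addnC.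
  have P1 : #|P| <= 1.
    by apply: card_nbrs_convex cvU => //; apply: subset_trans sUF; apply: subsetUr.
  apply: leq_trans (leq_add (leqnn _) P1); apply: leq_trans (leq_card_setU _ _).
  by apply/subset_leq_card/subsetP => x; rewrite !inE; case: (x \in D).
- apply: exchange_acyclic sDS _ acS _ => // u u' evu evu' uZ u'Z ru ru'.
  by apply: (card_le1_eqP few); rewrite inE ?evu ?evu' ?uZ ?u'Z.
Qed.

Lemma extendable_branch : 1 < #|rooted_nbrs| -> extendable D (v |: U) m ->
  (0 < m /\ extendable (v |: D) U m.-1) \/ (ncomp e W (v |: Z) < ncomp e W Z /\ extendable D U m).
Proof.
move=> many [S [sDS sSU cS acS]]; have [vS|vS] := boolP (v \in S); [left|right].
  have SE : S :\: (v |: D) = (S :\: D) :\ v by rewrite setUC setDDl.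
  have cE : #|S :\: D| = #|S :\: (v |: D)|.+1 by rewrite SE (cardsD1 v) in_setD vS vD.
  rewrite cE in cS; split; first exact: leq_ltn_trans (leq0n _) cS.
  exists S; split=> //; first by rewrite subUset sub1set vS.
  - by rewrite SE; apply/subsetP => x; rewrite in_setD1 => /andP[xv /(subsetP sSU)];
       rewrite in_setU1 (negPf xv).
  - by case: m cS.
split; last exact: extendable_keep sDS sSU cS acS vS.
have vW : v \notin W by case/setDP: vF.
have vZ : v \notin Z by rewrite !inE eqxx.
have acZ : acyclic (v |: Z).
  apply: acyclic_sub acS; rewrite subUset sub1set in_setD vS; case/setDP: vF => -> _ /=.
  apply/subsetP => x; rewrite 3!in_setD => /and3P[xU xD ->]; rewrite andbT.
  by apply: contra xU => xS; apply: (subsetP sSU); rewrite in_setD xD.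
case/card_gt1P: many => u [u' []].
move=> /and3P[evu uZ /existsP[w /andP[cuw wW]]].
move=> /and3P[evu' u'Z /existsP[w' /andP[cuw' wW']]] nuu'.
exact: (ncomp_add_lt e_sym vW vZ acZ nuu' evu evu' uZ u'Z wW wW' cuw cuw').
Qed.

End Processing.
End Extension.

(** * Rotor walks *)

Lemma iota0S m : iota 0 m.+1 = rcons (iota 0 m) m.
Proof. by rewrite -addn1 iotaD cats1. Qed.

Lemma foldr_if_find (A : Type) (P : pred nat) (g : nat -> A) d s :
  foldr (fun q acc => if P q then g q else acc) d s =
  if has P s then g (nth 0 s (find P s)) else d.
Proof. by elim: s => //= q s ->; case: (P q). Qed.

Section RotorWalk.
Variable n' : nat.
Local Notation n := n'.+1.
Variable e : rel 'I_n.
Hypothesis e_sym : symmetric e.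
Hypothesis e_irr : irreflexive e.
Implicit Types (Z : {set 'I_n}) (p c u y : 'I_n).

Definition rotate p q : 'I_n := Ordinal (ltn_pmod (p + q.+1) (ltn0Sn n')).

Definition next_nbr Z p c : 'I_n :=
  foldr (fun q acc => if e c (rotate p q) && (rotate p q \in Z) then rotate p q else acc)
    c (iota 0 n).

Definition walk_move Z (d : 'I_n * 'I_n) := (d.2, next_nbr Z d.1 d.2).
Definition walk Z u i : 'I_n := (iter i (walk_move Z) (u, u)).2.

(* Exceeds the number of darts, so that a walk of this length goes through a whole component. *)
Definition tour_len : nat := (n * n).+1.

Variant next_nbr_spec Z p c : 'I_n -> Prop :=
  | NextNbr q of q < n & e c (rotate p q) & rotate p q \in Z
      & (forall r, r < q -> ~~ (e c (rotate p r) && (rotate p r \in Z))) :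
      next_nbr_spec Z p c (rotate p q)
  | NoNbr of (forall q, q < n -> ~~ (e c (rotate p q) && (rotate p q \in Z))) :
      next_nbr_spec Z p c c.

Lemma next_nbrP Z p c : next_nbr_spec Z p c (next_nbr Z p c).
Proof.
rewrite /next_nbr; pose P q := e c (rotate p q) && (rotate p q \in Z).
rewrite (foldr_if_find P); case: ifP => hasP; last first.
  by constructor=> q qn; apply: contraFN hasP => Pq; apply/hasP; exists q; rewrite ?mem_iota.
have find_lt : find P (iota 0 n) < n by rewrite -[X in _ < X](size_iota 0 n) -has_find.
have /andP[enb Znb] : P (find P (iota 0 n)).
  by have := nth_find 0 hasP; rewrite nth_iota // add0n.
rewrite nth_iota // add0n; constructor=> // r rf.
by have := before_find 0 rf; rewrite nth_iota ?add0n ?(ltn_trans rf) // => /negbT.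
Qed.

Lemma rotate_onto p y : exists2 q, q < n & rotate p q = y.
Proof.
exists ((y + (n - p.+1)) %% n); first exact: ltn_pmod.
apply: val_inj => /=; rewrite -addSnnS modnDmr.
have -> : p.+1 + (y + (n - p.+1)) = y + n by have := ltn_ord p; lia.
by rewrite modnDr modn_small.
Qed.

Lemma rotate_rotate p q r : rotate (rotate p q) r = rotate p (q + r.+1).
Proof. by apply: val_inj => /=; rewrite modnDml; congr (_ %% _); lia. Qed.

Lemma rotate_sub p p' q q' :
  rotate p q = rotate p' q' -> q < q' -> rotate p' (q' - q.+1) = p.
Proof.
move=> /(congr1 val) /= /eqP eq_mod lt_q; apply: val_inj => /=; apply/eqP.
rewrite -[X in _ == X](modn_small (ltn_ord p)) -(eqn_modDr q.+1) eq_sym.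
by have -> : p' + (q' - q.+1).+1 + q.+1 = p' + q'.+1 by lia.
Qed.

Lemma rotate_inj q : injective (rotate^~ q).
Proof.
move=> p p' /(congr1 val) /= /eqP; rewrite eqn_modDr !modn_small // => /eqP.
exact: val_inj.
Qed.

Lemma next_nbr_move Z p c :
  next_nbr Z p c = c \/ e c (next_nbr Z p c) /\ next_nbr Z p c \in Z.
Proof. by case: next_nbrP => [q _ ? ? _|_]; [right|left]. Qed.

Lemma next_nbr_exists Z p c y :
  e c y -> y \in Z -> e c (next_nbr Z p c) /\ next_nbr Z p c \in Z.
Proof.
move=> ecy yZ; case: next_nbrP => [//|none].
by have [q qn qy] := rotate_onto p y; have := none q qn; rewrite qy ecy yZ.
Qed.

Lemma next_nbr_inj Z c : {in [pred p | e c p & p \in Z] &, injective (next_nbr Z ^~ c)}.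
Proof.
move=> p p' /andP[ecp pZ] /andP[ecp' p'Z].
have [q0 q0n q0E] := rotate_onto p p; have [q1 q1n q1E] := rotate_onto p' p'.
case: next_nbrP => [q qn _ _ q_min|none]; last by have := none _ q0n; rewrite q0E ecp pZ.
case: next_nbrP => [q' qn' _ _ q_min'|none]; last by have := none _ q1n; rewrite q1E ecp' p'Z.
move=> eq_rot; have [lt|lt|eqq] := ltngtP q q'.
- have := rotate_sub eq_rot lt; have : q' - q.+1 < q' by lia.
  by move=> /q_min' + pE; rewrite pE ecp pZ.
- have := rotate_sub (esym eq_rot) lt; have : q - q'.+1 < q by lia.
  by move=> /q_min + pE; rewrite pE ecp' p'Z.
- by move: eq_rot; rewrite eqq; apply: rotate_inj.
Qed.

Lemma next_nbr_orbit Z c (A : pred 'I_n) p y :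
  (forall x, A x -> A (next_nbr Z x c)) -> A p -> e c y -> y \in Z -> A y.
Proof.
move=> closA Ap ecy yZ; have [q qn qy] := rotate_onto p y.
have [m] := ubnP q; elim: m q p Ap qn qy => // m IHm q p Ap qn qy lqm.
have := closA p Ap; case: next_nbrP => [q0 q0n _ _ q0_min|none] Anext; last first.
  by have := none _ qn; rewrite qy ecy yZ.
have [lt|lt|eqq] := ltngtP q q0.
- by have := q0_min q lt; rewrite qy ecy yZ.
- apply: (IHm (q - q0.+1) (rotate p q0)) => //; try lia.
  by rewrite rotate_rotate; have -> : q0 + (q - q0.+1).+1 = q by lia.
- by rewrite -qy eqq.
Qed.

Lemma walk0 Z u : walk Z u 0 = u. Proof. by []. Qed.

Lemma walkS Z u i :
  walk Z u i.+1 = walk Z u i \/ e (walk Z u i) (walk Z u i.+1) /\ walk Z u i.+1 \in Z.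
Proof. rewrite /walk iterS /=; exact: next_nbr_move. Qed.

Lemma walk_mem Z u i : u \in Z -> walk Z u i \in Z.
Proof. by move=> uZ; elim: i => // i IHi; case: (walkS Z u i) => [->|[]]. Qed.

Lemma walk_conn Z u i : u \in Z -> conn e Z u (walk Z u i).
Proof.
move=> uZ; elim: i => [|i IHi]; first exact: conn_refl.
case: (walkS Z u i) => [->//|[exy yZ]]; apply: conn_trans IHi _.
by apply: conn_edge => //; apply: walk_mem.
Qed.

Section Tour.
Variable Z : {set 'I_n}.
Hypothesis acZ : acyclic e Z.

Local Notation dart d := (induced e Z d.1 d.2).
Definition tour_step (d : 'I_n * 'I_n) := if dart d then walk_move Z d else d.

Lemma tour_step_dart d : dart d -> dart (tour_step d).
Proof.
move=> dd; rewrite /tour_step dd /=; case/and3P: dd => edc pZ cZ.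
rewrite e_sym in edc; have [enx nxZ] := next_nbr_exists d.1 edc pZ.
by rewrite /induced enx cZ.
Qed.

Lemma tour_step_inj : injective tour_step.
Proof.
have step_nondart d : ~~ dart d -> tour_step d = d by rewrite /tour_step => /negPf ->.
have dart_step d : dart (tour_step d) = dart d.
  have [dd|/[dup] nd /step_nondart ->] := boolP (dart d); first exact: tour_step_dart.
  exact: negPf.
move=> d d' eq_step; have eq_dart : dart d = dart d' by rewrite -dart_step eq_step dart_step.
have [dd|nd] := boolP (dart d); last by rewrite -(step_nondart d) // eq_step step_nondart -?eq_dart.
have dd' : dart d' by rewrite -eq_dart.
move: eq_step; rewrite /tour_step dd dd' => -[].
case: d d' dd dd' {eq_dart} => [a b] [a' b'] /=.
case/and3P=> eab aZ _ /and3P[ea'b' a'Z _] eq_b; rewrite -eq_b in ea'b' *.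
by move/next_nbr_inj => ->; rewrite // inE e_sym ?eab ?ea'b'.
Qed.

Lemma fconnect_dart d d' : dart d -> fconnect tour_step d d' -> dart d'.
Proof.
move=> dd; case/connectP=> p; elim: p d dd => [|x p IHp] d dd /=; first by move=> _ ->.
by move=> /andP[/eqP E pth]; apply: IHp; rewrite // -E tour_step_dart.
Qed.

(* While the tour does not use the dart [(b, a)], it stays on the side of [b] of
   the edge [ab]. *)
Lemma tour_side a b d : dart (a, b) -> ~~ fconnect tour_step (a, b) (b, a) ->
  fconnect tour_step (a, b) d -> conn e (Z :\ a) b d.2.
Proof.
move=> dab not_back /connectP[p]; have /and3P[/= eab aZ bZ] := dab.
have bB : b \in Z :\ a by rewrite !inE bZ andbT; apply: contraTneq eab => ->; rewrite e_irr.
elim/last_ind: p d => [|p x IHp] d /=; first by move=> _ -> /=; apply: conn_refl.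
rewrite rcons_path last_rcons => /andP[pth /eqP xE] ->.
set y := last _ _ in xE *; have cby := IHp y pth erefl.
have fy : fconnect tour_step (a, b) y by apply/connectP; exists p.
have fx : fconnect tour_step (a, b) x by rewrite -xE; apply: connect_trans fy (fconnect1 _ _).
have x1E : x.1 = y.2 by rewrite -xE /tour_step (fconnect_dart dab fy).
have /and3P[ex x1Z x2Z] := fconnect_dart dab fx.
have yB : y.2 \in Z :\ a by apply: conn_mem cby.
have [xa|xa] := eqVneq x.2 a; last first.
  by apply: conn_trans cby _; apply: conn_edge; rewrite -?x1E // in_setD1 ?xa // x1E -in_setD1.
have yb : b = y.2.
  apply: (acyclic_nbr_unique e_sym (v := a) _ _ bB eab _ cby).
  - by rewrite !inE eqxx.
  - by rewrite setD1K.
  - by rewrite e_sym -x1E -xa.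
by case/negP: not_back; rewrite [(b, a)](_ : _ = x) // [x]surjective_pairing xa x1E -yb.
Qed.

(* The tour leaves the side of [b] only through the edge [ba], and, being a
   cycle of a permutation, it must leave. *)
Lemma fconnect_reverse a b : dart (a, b) -> fconnect tour_step (a, b) (b, a).
Proof.
move=> dab; apply: contraT => not_back; have /and3P[/= eab aZ bZ] := dab.
set d := finv tour_step (a, b); have dE : tour_step d = (a, b) := f_finv tour_step_inj _.
have fd : fconnect tour_step (a, b) d.
  by rewrite (fconnect_sym tour_step_inj) -dE fconnect1.
have := tour_side dab not_back fd.
move: dE; rewrite /tour_step (fconnect_dart dab fd) => -[-> _] /(conn_mem _).
rewrite !inE eqxx bZ andbT; apply.
by apply: contraTneq eab => ->; rewrite e_irr.
Qed.

Lemma fconnect_tour u x : let d := walk_move Z (u, u) in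
  dart d -> conn e Z u x -> exists y, fconnect tour_step d (y, x).
Proof.
move=> d dd cux; pose entered x := [exists y, fconnect tour_step d (y, x)].
have rev y z : fconnect tour_step d (y, z) -> fconnect tour_step d (z, y).
  by move=> f; apply: (connect_trans f); apply/fconnect_reverse/(fconnect_dart dd f).
suff /existsP : entered x by [].
apply: (conn_ind (P := entered) _ _ cux); last first.
  by apply/existsP; exists d.2; apply/rev; rewrite connect0.
move=> a b /existsP[y fya] aZ bZ eab; apply/existsP; exists a; apply/rev.
apply: (next_nbr_orbit (A := fun y => fconnect tour_step d (y, a)) _ fya eab bZ).
move=> z fza; apply/rev; apply: (connect_trans fza).
have -> : (a, next_nbr Z z a) = tour_step (z, a).
  by rewrite /tour_step (fconnect_dart dd fza).
exact: fconnect1.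
Qed.

Lemma walk_onto u y : u \in Z -> conn e Z u y ->
  exists2 i, i < tour_len & walk Z u i = y.
Proof.
move=> uZ cuy.
have [z /andP[euz zZ]|isolated] := pickP (fun z => e u z && (z \in Z)); last first.
  exists 0 => //; rewrite walk0; apply/eqP.
  apply: (conn_ind (P := eq_op u) _ _ cuy) => // a b /eqP <- _ bZ eab.
  by have := isolated b; rewrite eab bZ.
set d := walk_move Z (u, u).
have dd : dart d by have [eud dZ] := next_nbr_exists u euz zZ; rewrite /induced eud uZ.
have walkE i : iter i.+1 (walk_move Z) (u, u) = iter i tour_step d /\ dart (iter i tour_step d).
  elim: i => [//|i [IHi di]]; split; last by rewrite iterS tour_step_dart.
  by rewrite iterS IHi [in RHS]iterS {2}/tour_step di.
have [x fx] := fconnect_tour dd cuy.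
exists (findex tour_step d (x, y)).+1; last by rewrite /walk (walkE _).1 iter_findex.
rewrite ltnS; apply: leq_trans (findex_max fx) (leq_trans (max_card _) _).
by rewrite card_prod card_ord.
Qed.

End Tour.
End RotorWalk.

(** * The algorithm on graphs *)

Lemma foldr_iotaS (A : Type) (f : nat -> A -> A) x m :
  foldr f x (iota 0 m.+1) = foldr f (f m x) (iota 0 m).
Proof. by rewrite iota0S foldr_rcons. Qed.

Lemma eq_in_foldr (I : eqType) (A : Type) (f g : I -> A -> A) x s :
  (forall i, i \in s -> f i =1 g i) -> foldr f x s = foldr g x s.
Proof.
elim: s => //= i s IHs fg; rewrite fg ?mem_head // IHs // => j js.
by apply: fg; rewrite inE js orbT.
Qed.

Section Model.
Variable n' : nat.
Local Notation n := n'.+1.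
Variable e : rel 'I_n.
Implicit Types (Z F : {set 'I_n}) (u v : 'I_n) (sl wl ys : seq nat).

(* Vertex lists hold [v.+1] for the vertex [v], so that 0 marks an empty entry. *)
Definition vset sl : {set 'I_n} := [set x : 'I_n | x.+1 \in sl].
Definition below i : {set 'I_n} := [set x : 'I_n | x < i].

(* The time [t = r * tour_len n' + j] stands for step [j] of the walk from [r]. *)
Definition tour_pos F t : option 'I_n :=
  let root := inord (t %/ tour_len n') in
  if root \in F then Some (walk e F root (t %% tour_len n')) else None.
Definition visited F t : {set 'I_n} :=
  [set x | has (fun t' => tour_pos F t' == Some x) (iota 0 t)].

Definition walk_hits Z u (P : pred 'I_n) : bool :=
  has (fun j => P (walk e Z u j)) (iota 0 (tour_len n')).
Definition linked Z v (P : 'I_n -> pred 'I_n) : nat :=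
  count (fun q => [&& e v (inord q), inord q \in Z & walk_hits Z (inord q) (P (inord q))])
    (iota 0 n).

Definition old_graph i wl : {set 'I_n} := below i :\: vset wl.
Definition live_at i F sl t : {set 'I_n} := live (below i) (vset sl) (visited F t).

(* The state consists of the deleted vertices and of the number of bits of [Y]
   that have been used. *)
Definition guess_step i wl k (Y : nat -> nat) t (st : seq nat * nat) : seq nat * nat :=
  let F := old_graph i wl in
  let: (sl, used) := st in
  if tour_pos F t is Some v then
    if v \in visited F t then st
    else if (1 < linked (live_at i F sl t.+1) v (fun _ x => x \in vset wl)) && (used < k.*2.+2)
    then (if (Y used != 0) && (size sl < k) then rcons sl v.+1 else sl, used.+1)
    else st
  else st.

Definition digit_step wl k (x : nat -> nat) j (st : seq nat * seq nat) :=
  let: (sl, ys) := st in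
  if x j == 0 then (if size sl < k then rcons sl (nth 0 wl j) else sl, ys)
  else (sl, ys ++ [:: (x j).-1 %% 2; (x j).-1 %/ 2]).

Definition candidate i wl k x : seq nat :=
  let: (sl, ys) := foldr (digit_step wl k x) ([::], [::]) (iota 0 k.+1) in
  (foldr (guess_step i wl k (nth 0 ys)) (sl, 0) (iota 0 (n * tour_len n'))).1.

Definition check_vertex sl v : bool :=
  (v \in vset sl) ||
  (linked (live_at v set0 sl 0) v (fun u x => (x != u) && e v x) == 0).
Definition check i sl : bool := all (fun q => check_vertex sl (inord q)) (iota 0 i).

Lemma in_vset v sl : (v \in vset sl) = (v.+1 \in sl).
Proof. by rewrite inE. Qed.

Lemma in_below v i : (v \in below i) = (v < i).
Proof. by rewrite inE. Qed.

Lemma below0 : below 0 = set0.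
Proof. by apply/setP => x; rewrite !inE. Qed.

Lemma succ_ord_inj : injective (fun v : 'I_n => v.+1).
Proof. by move=> u v [] /val_inj. Qed.

Lemma card_vset sl : #|vset sl| <= size sl.
Proof.
rewrite cardE -(size_map (fun v : 'I_n => v.+1)); apply: uniq_leq_size.
  by rewrite (map_inj_uniq succ_ord_inj) enum_uniq.
by move=> q /mapP[v]; rewrite mem_enum in_vset => vsl ->.
Qed.

Lemma vset_rcons sl v : vset (rcons sl v.+1) = v |: vset sl.
Proof. by apply/setP => x; rewrite in_setU1 !in_vset mem_rcons inE (inj_eq succ_ord_inj). Qed.

Lemma visited0 F : visited F 0 = set0.
Proof. by apply/setP => x; rewrite !inE. Qed.

Lemma visitedS F t :
  visited F t.+1 = if tour_pos F t is Some v then v |: visited F t else visited F t.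
Proof.
apply/setP => x; rewrite inE iota0S has_rcons.
case: (tour_pos F t) => [v|]; rewrite ?inE //.
by congr orb; rewrite (inj_eq Some_inj) eq_sym.
Qed.

Lemma live_at0 i F sl : live_at i F sl 0 = below i :\: vset sl.
Proof. by rewrite /live_at /live visited0 setD0. Qed.

Lemma tour_pos_at F r j : r < n -> j < tour_len n' ->
  tour_pos F (r * tour_len n' + j) =
  if inord r \in F then Some (walk e F (inord r) j) else None.
Proof.
by move=> rn jl; rewrite /tour_pos divnMDl // modnMDl divn_small // modn_small // addn0.
Qed.

Lemma mem_visited F t t' v : tour_pos F t = Some v -> t < t' -> v \in visited F t'.
Proof.
by move=> posE lt; rewrite inE; apply/hasP; exists t; rewrite ?posE // mem_iota.
Qed.

Lemma visitedP F t v : v \in visited F t -> exists2 t', t' < t & tour_pos F t' = Some v.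
Proof. by rewrite inE => /hasP[t']; rewrite mem_iota => lt /eqP; exists t'. Qed.

Lemma tour_pos_mem F t v : tour_pos F t = Some v -> v \in F.
Proof. by rewrite /tour_pos; case: ifP => // rF [<-]; apply: walk_mem. Qed.

Lemma visited_sub F t : visited F t \subset F.
Proof. by apply/subsetP => v /visitedP[t' _ /tour_pos_mem]. Qed.

Lemma visited_all F : visited F (n * tour_len n') = F.
Proof.
apply/eqP; rewrite eqEsubset visited_sub; apply/subsetP => v vF.
apply: (@mem_visited _ (v * tour_len n' + 0)); first by rewrite tour_pos_at // inord_val vF.
by rewrite addn0 ltn_pmul2r.
Qed.

Lemma count_inord (A : pred 'I_n) : count (fun q => A (inord q)) (iota 0 n) = #|A|.
Proof.
have enumE : enum 'I_n = map inord (iota 0 n).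
  by rewrite -val_enum_ord -map_comp -[LHS]map_id; apply: eq_map => x /=; rewrite inord_val.
rewrite -sum1_card -sum1_count [RHS]big_mkcond -big_enum enumE big_map /= -big_mkcond.
exact: eq_bigl.
Qed.

Section SimpleGraph.
Hypothesis e_sym : symmetric e.
Hypothesis e_irr : irreflexive e.

Lemma walk_hitsE Z u P : acyclic e Z -> u \in Z -> walk_hits Z u P = reaches e Z P u.
Proof.
move=> acZ uZ; apply/hasP/existsP => [[j _ Pj]|[x /andP[cux Px]]].
  by exists (walk e Z u j); rewrite Pj walk_conn.
have [j jl E] := walk_onto e_sym e_irr acZ uZ cux.
by exists j; rewrite ?mem_iota // E.
Qed.

Lemma linkedE Z v P : acyclic e Z ->
  linked Z v P = #|[pred u | [&& e v u, u \in Z & reaches e Z (P u) u]]|.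
Proof.
move=> acZ; rewrite /linked (count_inord [pred u | [&& e v u, u \in Z & walk_hits Z u (P u)]]).
apply: eq_card => u; rewrite !inE; case uZ: (u \in Z); last by rewrite !andbF.
by rewrite walk_hitsE.
Qed.

Lemma linked_eq0 Z v : acyclic e Z -> v \notin Z ->
  linked Z v (fun u x => (x != u) && e v x) = 0 <-> acyclic e (v |: Z).
Proof.
move=> acZ vZ; rewrite linkedE //; split=> [/card0_eq none|acv].
  apply: (acyclic_add e_sym acZ) => u u' uZ evu evu' cuu'; apply/eqP.
  have := none u; rewrite !inE evu uZ /= => /negbT/existsPn/(_ u').
  by rewrite cuu' evu' andbT negbK eq_sym.
apply: eq_card0 => u; rewrite !inE; apply/negP => /and3P[evu uZ /existsP[x]].
case/and3P=> cux /eqP nxu evx; apply: nxu.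
exact/esym/(acyclic_nbr_unique e_sym vZ acv uZ evu evx cux).
Qed.

Lemma below_split i sl : i < n -> let v : 'I_n := inord i in
  below i.+1 :\: vset sl =
  if v \in vset sl then below i :\: vset sl else v |: (below i :\: vset sl).
Proof.
move=> lin /=; have vE : (inord i : 'I_n) = i :> nat by rewrite inordK.
set v : 'I_n := inord i in vE *; apply/setP => x.
have xE : (x < i.+1) = (x == v) || (x < i) by rewrite ltnS leq_eqVlt -{1}vE.
case: ifP => vsl; rewrite ?in_setU1 !in_setD !in_below xE.
  by case: eqP => [->|_] //; rewrite vsl vE ltnn.
by case: eqP => [->|_] //; rewrite vsl.
Qed.

Lemma checkP i sl : i <= n -> check i sl <-> acyclic e (below i :\: vset sl).
Proof.
elim: i => [|i IHi] lin; first by rewrite below0 set0D; split=> // _; apply: acyclic0.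
have vE : (inord i : 'I_n) = i :> nat by rewrite inordK.
have {}IHi := IHi (ltnW lin).
rewrite below_split // /check iota0S all_rcons /check_vertex -/(check i sl) live_at0 vE.
set v : 'I_n := inord i in vE *.
case: ifP => [//|vsl] /=.
have vB : v \notin below i :\: vset sl by rewrite !inE vE ltnn andbF.
split=> [/andP[/eqP none /IHi acB]|acv]; first exact/linked_eq0.
have acB : acyclic e (below i :\: vset sl) by apply: acyclic_sub acv; apply: subsetUr.
by apply/andP; split; [apply/eqP/linked_eq0 | apply/IHi].
Qed.

Section VisitOrder.
Variable F : {set 'I_n}.
Hypothesis acF : acyclic e F.

Lemma visited_component r j z y : r < n -> j < tour_len n' ->
  tour_pos F (r * tour_len n' + j) = Some z -> conn e F z y ->
  y \in visited F (r.+1 * tour_len n').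
Proof.
move=> rn jl; rewrite tour_pos_at //; case: ifP => // rF [<-] czy.
have cry : conn e F (inord r) y by apply: conn_trans czy; apply: walk_conn.
have [j' jl' j'E] := walk_onto e_sym e_irr acF rF cry.
apply: (@mem_visited _ (r * tour_len n' + j')); first by rewrite tour_pos_at ?rF ?j'E.
by rewrite mulSn addnC ltn_add2r.
Qed.

Lemma first_visit_nbr t v z : t < n * tour_len n' -> tour_pos F t = Some v ->
  v \notin visited F t -> z \in visited F t -> conn e F z v ->
  exists2 p, p \in visited F t & e p v.
Proof.
move=> lt posE vt zt czv; have rn : t %/ tour_len n' < n by rewrite ltn_divLR.
have jl := ltn_pmod t (ltn0Sn (n * n)); rewrite -/(tour_len n') in jl.
rewrite (divn_eq t (tour_len n')) in posE; move: posE.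
case jE: (t %% tour_len n') jl => [|j] jl; last first.
  rewrite tour_pos_at //; case: ifP => // rF [vE].
  have pt : walk e F (inord (t %/ tour_len n')) j \in visited F t.
    apply: (@mem_visited _ (t %/ tour_len n' * tour_len n' + j)).
      by rewrite tour_pos_at ?rF // ltnW.
    by rewrite [ltnRHS](divn_eq t (tour_len n')) jE ltn_add2l.
  exists (walk e F (inord (t %/ tour_len n')) j) => //.
  case: (walkS e F (inord (t %/ tour_len n')) j) => [stay|[move_edge _]]; last by rewrite -vE.
  by rewrite -vE stay pt in vt.
have [t' lt_t' pos_t'] := visitedP zt.
have lt_root : t' %/ tour_len n' < t %/ tour_len n'.
  by rewrite ltn_divLR // (leq_trans lt_t') // [leqLHS](divn_eq t (tour_len n')) jE addn0.
rewrite (divn_eq t' (tour_len n')) in pos_t'.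
have := visited_component (ltn_trans lt_root rn) (ltn_pmod _ (ltn0Sn _)) pos_t' czv.
case/visitedP=> t'' lt_t'' pos_t''; case/negP: vt; apply: (mem_visited pos_t'').
apply: leq_trans lt_t'' _; apply: leq_trans (leq_divM t (tour_len n')).
by rewrite leq_mul2r lt_root orbT.
Qed.

Lemma visited_convex t : t <= n * tour_len n' -> convex e F (visited F t).
Proof.
elim: t => [|t IHt] lt; first by rewrite visited0 => x y; rewrite inE.
have {}IHt := IHt (ltnW lt).
rewrite visitedS; case posE: (tour_pos F t) => [v|] //.
have [vt|vt] := boolP (v \in visited F t); first by rewrite (setUidPr _) ?sub1set.
have vF := tour_pos_mem posE.
have sub : visited F t \subset v |: visited F t by apply: subsetUr.
have conn_new z : z \in visited F t -> conn e F z v -> conn e (v |: visited F t) z v.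
  move=> zt czv; have [p pt epv] := first_visit_nbr lt posE vt zt czv.
  have pF : p \in F := subsetP (visited_sub F t) p pt.
  have cpv : conn e (v |: visited F t) p v.
    by apply: conn_edge; rewrite // in_setU1 ?eqxx ?pt ?orbT.
  apply: conn_trans cpv; apply: (conn_sub sub); apply: IHt => //.
  by apply: (conn_trans czv); rewrite (conn_sym e_sym); apply: conn_edge.
move=> x y; rewrite !in_setU1 => /orP[/eqP->|xt] /orP[/eqP->|yt] cxy.
- exact: conn_refl.
- by rewrite (conn_sym e_sym); apply: conn_new; rewrite // (conn_sym e_sym).
- exact: conn_new.
- by apply: (conn_sub sub); apply: IHt.
Qed.

End VisitOrder.
End SimpleGraph.
End Model.
Arguments vset {n'}.
Arguments below {n'}.
Arguments old_graph {n'}.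

(** * Completeness of the guesses *)

Section Guesses.
Variable n' : nat.
Local Notation n := n'.+1.
Variable e : rel 'I_n.
Hypothesis e_sym : symmetric e.
Hypothesis e_irr : irreflexive e.
Variables (i k : nat) (wl : seq nat).
Local Notation V := (below i).
Local Notation W := (vset wl : {set 'I_n}).
Local Notation F := (old_graph i wl).
Hypothesis acF : acyclic e F.
Local Notation remaining sl t := (live_at e i F sl t).
Local Notation run Y sl used t :=
  (foldr (guess_step e i wl k Y) (sl, used) (iota 0 t)).1.

Definition enough_guesses t sl : Prop :=
  exists2 bs : seq bool, size bs <= (k - size sl) + ncomp e W (remaining sl t) &
    forall (Y : nat -> nat) used,
      (forall j, j < size bs -> Y (used + j) = nth false bs j) ->
      used + size bs <= k.*2.+2 -> acyclic e (V :\: vset (run Y sl used t)).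

Lemma enough_guesses_idle t sl :
  (forall Y used, guess_step e i wl k Y t (sl, used) = (sl, used)) ->
  ncomp e W (remaining sl t) <= ncomp e W (remaining sl t.+1) ->
  enough_guesses t sl -> enough_guesses t.+1 sl.
Proof.
move=> idle le_comp [bs sbs bsP]; exists bs; first by apply: leq_trans sbs _; rewrite leq_add2l.
by move=> Y used Ybs used_le; rewrite foldr_iotaS idle; apply: bsP.
Qed.

Lemma enough_guesses_cons (b : bool) t sl sl' :
  (forall (Y : nat -> nat) used, Y used = b -> used < k.*2.+2 ->
     guess_step e i wl k Y t (sl, used) = (sl', used.+1)) ->
  (k - size sl') + ncomp e W (remaining sl' t) < (k - size sl) + ncomp e W (remaining sl t.+1) ->
  enough_guesses t sl' -> enough_guesses t.+1 sl.
Proof.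
move=> stepE lt_budget [bs sbs bsP]; exists (b :: bs); first exact: leq_ltn_trans sbs _.
move=> Y used Ybs; rewrite [size _]/= addnS => used_le.
rewrite foldr_iotaS stepE; first 1 last.
- by have := Ybs 0 isT; rewrite addn0.
- by apply: leq_trans used_le; rewrite ltnS leq_addr.
by apply: bsP; rewrite ?addSn // => j jl; rewrite addSnnS (Ybs j.+1).
Qed.

Section Visit.
Variables (t : nat) (v : 'I_n) (sl : seq nat).
Hypotheses (lt_t : t < n * tour_len n') (posE : tour_pos e F t = Some v).
Hypothesis new_v : v \notin visited e F t.
Hypothesis dis : [disjoint vset sl & visited e F t.+1].
Hypothesis ext : extendable e V (vset sl) (visited e F t.+1) (k - size sl).
Hypothesis enough_before : forall sl', [disjoint vset sl' & visited e F t] ->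
  extendable e V (vset sl') (visited e F t) (k - size sl') -> enough_guesses t sl'.
Local Notation root_links := (linked e (remaining sl t.+1) v (fun _ x => x \in W)).

Lemma visited_visit : visited e F t.+1 = v |: visited e F t.
Proof. by rewrite visitedS posE. Qed.

Lemma visit_sub : v |: visited e F t \subset F.
Proof. by rewrite -visited_visit visited_sub. Qed.

Lemma visit_undeleted : v \notin vset sl.
Proof.
apply: contraTN dis => vsl; apply/pred0Pn; exists v.
by rewrite /= vsl visited_visit setU11.
Qed.

Lemma remaining_visit : remaining sl t = v |: remaining sl t.+1.
Proof.
have /setDP[vV _] := tour_pos_mem posE.
by rewrite /live_at visited_visit -live_add ?visit_undeleted.
Qed.

Lemma disjoint_visit : [disjoint vset sl & visited e F t].
Proof. by apply: disjointWr dis; rewrite visited_visit subsetUr. Qed.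

Lemma root_linksE : let Z := live V (vset sl) (v |: visited e F t) in
  root_links = #|[pred u | [&& e v u, u \in Z & reaches e Z [in W] u]]|.
Proof.
rewrite /= -visited_visit; apply: (linkedE e_sym e_irr).
case: ext => S [sDS sSU _ acS]; apply: acyclic_sub acS; apply/subsetP => x.
rewrite !in_setD => /and3P[xU xD ->]; rewrite andbT.
by apply: contra xU => xS; apply: (subsetP sSU); rewrite in_setD xD.
Qed.

Lemma guess_step_visit Y used : guess_step e i wl k Y t (sl, used) =
  if (1 < root_links) && (used < k.*2.+2)
  then (if (Y used != 0) && (size sl < k) then rcons sl v.+1 else sl, used.+1)
  else (sl, used).
Proof. by rewrite /guess_step posE (negPf new_v). Qed.

Lemma enough_guesses_forced : root_links <= 1 -> enough_guesses t.+1 sl.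
Proof.
move=> few; apply: enough_guesses_idle.
- by move=> Y used; rewrite guess_step_visit ltnNge few.
- by rewrite remaining_visit ncomp_add //; case/setDP: (tour_pos_mem posE).
- apply: enough_before; first exact: disjoint_visit.
  have cvU := visited_convex e_sym e_irr acF (ltnW lt_t).
  have := visited_convex e_sym e_irr acF lt_t; rewrite visited_visit => cvUv.
  have := ext; rewrite visited_visit; apply: (extendable_forced e_sym acF) => //.
  + exact: visit_sub.
  + exact: visit_undeleted.
  + by rewrite -root_linksE.
Qed.

Lemma enough_guesses_branch : 1 < root_links -> enough_guesses t.+1 sl.
Proof.
move=> many; have stepE Y used : used < k.*2.+2 -> guess_step e i wl k Y t (sl, used) =
    (if (Y used != 0) && (size sl < k) then rcons sl v.+1 else sl, used.+1).
  by rewrite guess_step_visit many => ->.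
have := ext; rewrite visited_visit => /(extendable_branch e_sym visit_sub visit_undeleted).
rewrite -root_linksE => /(_ many)[[lt_k del]|[lt_comp keep]].
- rewrite subn_gt0 in lt_k.
  apply: (enough_guesses_cons (b := true) (sl' := rcons sl v.+1)).
  + by move=> Y used Yu lt_used; rewrite stepE // Yu lt_k.
  + have -> : remaining (rcons sl v.+1) t = remaining sl t.+1.
      by rewrite /live_at visited_visit vset_rcons /live !setDDl setUAC setUC setUCA setUC.
    by rewrite size_rcons ltn_add2r subnS ltn_predL subn_gt0.
  + apply: enough_before; rewrite ?vset_rcons ?size_rcons ?subnS //.
    by rewrite disjoints_subset subUset sub1set inE new_v -disjoints_subset disjoint_visit.
- apply: (enough_guesses_cons (b := false) (sl' := sl)).
  + by move=> Y used Yu lt_used; rewrite stepE // Yu.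
  + by rewrite remaining_visit ltn_add2l /live_at visited_visit.
  + exact: enough_before disjoint_visit keep.
Qed.

End Visit.

Lemma enough_guesses_extendable t sl : t <= n * tour_len n' ->
  [disjoint vset sl & visited e F t] ->
  extendable e V (vset sl) (visited e F t) (k - size sl) -> enough_guesses t sl.
Proof.
elim: t sl => [|t IHt] sl lt dis ext.
  rewrite visited0 in ext.
  by exists [::] => // Y used _ _; apply: extendable0 ext.
have {}IHt sl' := IHt sl' (ltnW lt).
case posE: (tour_pos e F t) => [v|]; last first.
  have visE : visited e F t.+1 = visited e F t by rewrite visitedS posE.
  rewrite visE in dis ext; apply: enough_guesses_idle (IHt sl dis ext).
    by move=> Y used; rewrite /guess_step posE.
  by rewrite /live_at visE.
have [vt|vt] := boolP (v \in visited e F t); last first.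
  have [many|few] := ltnP 1 (linked e (remaining sl t.+1) v (fun _ x => x \in W)).
    exact: (enough_guesses_branch posE vt dis ext IHt).
  exact: (enough_guesses_forced lt posE vt dis ext IHt).
have visE : visited e F t.+1 = visited e F t by rewrite visitedS posE (setUidPr _) ?sub1set.
rewrite visE in dis ext; apply: enough_guesses_idle (IHt sl dis ext).
  by move=> Y used; rewrite /guess_step posE vt.
by rewrite /live_at visE.
Qed.

Lemma exists_digits (zero : pred nat) (bs : seq bool) m :
  size bs <= (count (predC zero) (iota 0 m)).*2 ->
  exists2 x : nat -> nat, forall j, x j < 5 &
    exists2 ys', forall j, j < size bs -> nth 0 ys' j = nth false bs j &
      forall sl ys, size sl + count zero (iota 0 m) <= k ->
        foldr (digit_step wl k x) (sl, ys) (iota 0 m) =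
        (sl ++ [seq nth 0 wl q | q <- rev [seq q <- iota 0 m | zero q]], ys ++ ys').
Proof.
elim: m bs => [|m IHm] bs.
  rewrite leqn0 => /nilP ->; exists (fun=> 0) => //; exists [::] => // sl ys _.
  by rewrite !cats0.
have count_rcons (a : pred nat) s q : count a (rcons s q) = count a s + a q.
  by rewrite -cats1 count_cat /= addn0.
rewrite iota0S filter_rcons !count_rcons /=.
have [zm|zm] := boolP (zero m) => /= sbs.
  have [|x x5 [ys' bsE runE]] := IHm bs; first by rewrite addn0 in sbs.
  exists (fun j => if j == m then 0 else x j); first by move=> j; case: ifP.
  exists ys' => // sl ys sz; rewrite foldr_rcons rev_rcons /= eqxx.
  have lt_k : size sl < k by lia.
  rewrite lt_k /= -cat_rcons -runE; last by rewrite size_rcons; lia.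
  by apply: eq_in_foldr => j; rewrite mem_iota => jm [? ?]; rewrite /digit_step (ltn_eqF jm).
have [|x x5 [ys' bsE runE]] := IHm (drop 2 bs); first by rewrite size_drop; lia.
pose b j := nat_of_bool (nth false bs j).
have b2 j : b j < 2 by rewrite /b; case: nth.
pose d := (b 0 + (b 1).*2).+1.
exists (fun j => if j == m then d else x j).
  by move=> j; case: ifP => // _; have := b2 0; have := b2 1; rewrite /d; lia.
exists ([:: b 0; b 1] ++ ys').
  case=> [|[|j]] //= jl; rewrite bsE ?nth_drop ?add2n // size_drop; lia.
move=> sl ys sz; rewrite foldr_rcons /= eqxx.
have -> : d.-1 %% 2 = b 0 by have := b2 0; rewrite /d; lia.
have -> : d.-1 %/ 2 = b 1 by have := b2 0; rewrite /d; lia.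
rewrite -[[:: b 0, b 1 & ys']]/([:: b 0; b 1] ++ ys') catA -runE; last by lia.
by apply: eq_in_foldr => j; rewrite mem_iota => jm [? ?]; rewrite /digit_step (ltn_eqF jm).
Qed.

Lemma select_vset (A : {set 'I_n}) m : size wl <= m -> A \subset W ->
  exists zero : pred nat, count zero (iota 0 m) = #|A| /\
    vset [seq nth 0 wl q | q <- rev [seq q <- iota 0 m | zero q]] = A.
Proof.
move=> wl_m /subsetP sAW; pose idx (v : 'I_n) := index v.+1 wl.
have nth_idx v : v \in A -> nth 0 wl (idx v) = v.+1.
  by move=> /sAW; rewrite in_vset => /(nth_index 0).
pose zero := [in [seq idx v | v in A]].
have zeroP : perm_eq [seq q <- iota 0 m | zero q] [seq idx v | v in A].
  apply: uniq_perm; first by rewrite filter_uniq ?iota_uniq.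
    rewrite map_inj_in_uniq ?enum_uniq // => u v; rewrite !mem_enum => uA vA eq_idx.
    by apply: succ_ord_inj; rewrite -(nth_idx u) // eq_idx nth_idx.
  move=> q; rewrite mem_filter mem_iota /=; apply: andb_idr => /imageP[v /sAW].
  by rewrite in_vset -index_mem => lt -> /=; apply: leq_trans wl_m.
exists zero; split; first by rewrite -size_filter (perm_size zeroP) size_image.
apply/setP => v; rewrite in_vset; apply/mapP/idP => [[q]|vA].
  rewrite mem_rev (perm_mem zeroP) => /imageP[u uA ->].
  by rewrite nth_idx // => /succ_ord_inj ->.
by exists (idx v); rewrite ?nth_idx // mem_rev (perm_mem zeroP) image_f.
Qed.

Lemma candidate_complete (S : {set 'I_n}) : size wl <= k.+1 -> #|S| <= k -> acyclic e (V :\: S) ->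
  exists2 x : nat -> nat, forall j, x j < 5 & acyclic e (V :\: vset (candidate e i wl k x)).
Proof.
move=> wl_k; wlog sSV : S / S \subset V => [restrict|] cS acS.
  apply: (restrict (S :&: V)); first exact: subsetIr.
    by apply: leq_trans cS; apply: subset_leq_card; apply: subsetIl.
  by rewrite setDIr setDv setU0.
have [zero [card_zero vsetE]] := select_vset wl_k (subsetIl W S).
set sl0 := map _ _ in vsetE.
have size_sl0 : size sl0 = #|W :&: S| by rewrite size_map size_rev size_filter.
have := count_predC zero (iota 0 k.+1); rewrite size_iota card_zero => card_nonzero.
have le_comp : ncomp e W (remaining sl0 (n * tour_len n')) <= count (predC zero) (iota 0 k.+1).
  apply: leq_trans (ncomp_le_card _ _ _) (@leq_trans #|W :\: S| _ _ _ _).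
    apply/subset_leq_card/subsetP => v; rewrite /live_at /live vsetE !inE.
    by case: (v.+1 \in wl); case: (v \in S); rewrite ?andbF.
  by rewrite -(leq_add2l #|W :&: S|) card_nonzero cardsID; apply: leq_trans (card_vset _ _) wl_k.
have S_k := leq_trans (subset_leq_card (subsetIr W S)) cS.
have [||bs sbs bsP] := @enough_guesses_extendable (n * tour_len n') sl0 (leqnn _).
- by rewrite visited_all vsetE disjoints_subset; apply/subsetP => v; rewrite !inE => /andP[->].
- exists S; rewrite visited_all vsetE; split=> //; first exact: subsetIr.
    apply/subsetP => v; rewrite !inE => /andP[+ vS]; rewrite vS andbT => ->.
    by have := subsetP sSV v vS; rewrite inE.
  by rewrite size_sl0 setDIr setDv setU0 leq_subRL // setIC cardsID.
have [|x x5 [ys ysE runE]] := @exists_digits zero bs k.+1; first by rewrite size_sl0 in sbs; lia.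
exists x => //; rewrite /candidate runE; last by rewrite card_zero.
by apply: bsP => //; rewrite add0n; rewrite size_sl0 in sbs; lia.
Qed.

Lemma size_candidate x : size (candidate e i wl k x) <= k.
Proof.
have size_digits m sl ys :
    size sl <= k -> size (foldr (digit_step wl k x) (sl, ys) (iota 0 m)).1 <= k.
  elim: m sl ys => [|m IHm] sl ys sl_k //; rewrite foldr_iotaS /digit_step.
  case: (x m == 0); apply: IHm => //.
  by case: ltnP => //; rewrite size_rcons.
have size_guesses Y t sl used :
    size sl <= k -> size (foldr (guess_step e i wl k Y) (sl, used) (iota 0 t)).1 <= k.
  elim: t sl used => [|t IHt] sl used sl_k //; rewrite foldr_iotaS /guess_step.
  case: (tour_pos _ _ _) => [v|]; last exact: IHt.
  case: (v \in _); first exact: IHt.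
  case: (_ && _); last exact: IHt.
  apply: IHt; case: (Y used != 0) => //=.
  by case: ltnP => //; rewrite size_rcons.
rewrite /candidate; have := size_digits k.+1 [::] [::] (leq0n _).
by case: (foldr _ _ _) => sl ys sl_k; apply/size_guesses/sl_k.
Qed.

Lemma eq_candidate x x' :
  (forall j, j <= k -> x j = x' j) -> candidate e i wl k x = candidate e i wl k x'.
Proof.
move=> eq_x; rewrite /candidate; congr (let: (sl, ys) := _ in _).
by apply: eq_in_foldr => j; rewrite mem_iota => jk [sl ys]; rewrite /digit_step eq_x.
Qed.

End Guesses.

(** * Structured programs *)

Inductive expr :=
  | Reg (r : nat) | Cst (v : nat) | Op (o : binop) (a b : expr)
  | Inp (a : expr) | Arr (q : nat) (a : expr).

Inductive prog :=
  | Nop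
  | Assign (r : nat) (a : expr)
  | Store (q : nat) (l a : expr)
  | Then (p1 p2 : prog)
  | Ifte (a : expr) (p1 p2 : prog)
  | Loop (r : nat) (p : prog).

(* Machine cells 0 .. 7 are the stack for the evaluation of expressions.  They
   are followed by the registers and by four interleaved arrays. *)
Definition stack : nat := 8.
Definition regs : nat := 64.
Definition reg_addr r : nat := stack + r.
Definition arr_addr q j : nat := j * 4 + (stack + regs + q).
Definition words cap : nat := stack + regs + 4 * cap.

Definition compile_op o d ca cb : cmd := Seq ca (Seq cb (Bin o d d d.+1)).
Definition compile_addr q d c : cmd :=
  compile_op Add d (compile_op Mul d c (Const d.+1 4)) (Const d.+1 (stack + regs + q)).

Fixpoint compile_expr (a : expr) (d : nat) : cmd :=
  match a with
  | Reg r => Seq (Const d (reg_addr r)) (LoadInd d d)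
  | Cst v => Const d v
  | Op o a b => compile_op o d (compile_expr a d) (compile_expr b d.+1)
  | Inp a => Seq (compile_expr a d) (Read d d)
  | Arr q a => Seq (compile_addr q d (compile_expr a d)) (LoadInd d d)
  end.

Fixpoint compile (p : prog) : cmd :=
  match p with
  | Nop => Skip
  | Assign r a => Seq (compile_expr a 0) (Seq (Const 1 (reg_addr r)) (StoreInd 1 0))
  | Store q l a =>
      Seq (compile_expr a 0) (Seq (compile_addr q 1 (compile_expr l 1)) (StoreInd 1 0))
  | Then p1 p2 => Seq (compile p1) (compile p2)
  | Ifte a p1 p2 => Seq (compile_expr a 0) (If 0 (compile p1) (compile p2))
  | Loop r p => While (reg_addr r) (compile p)
  end.

Fixpoint cost (a : expr) : nat :=
  match a with
  | Reg _ => 2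
  | Cst _ => 1
  | Op _ a b => cost a + (cost b + 1)
  | Inp a => cost a + 1
  | Arr _ a => cost a + 5
  end.

Fixpoint fits_stack (d : nat) (a : expr) : bool :=
  match a with
  | Reg r => (d < stack) && (r < regs)
  | Cst v => (d < stack) && (v < 1000)
  | Op _ a b => [&& d.+1 < stack, fits_stack d a & fits_stack d.+1 b]
  | Inp a => (d < stack) && fits_stack d a
  | Arr q a => [&& d.+1 < stack, q < 4 & fits_stack d a]
  end.

Definition compilable d a : bool := fits_stack d a && (cost a <= 400).

Fixpoint written_regs (p : prog) : seq nat :=
  match p with
  | Assign r _ => [:: r]
  | Then p1 p2 | Ifte _ p1 p2 => written_regs p1 ++ written_regs p2
  | Loop _ p => written_regs p
  | _ => [::]
  end.

Fixpoint written_arrs (p : prog) : seq nat :=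
  match p with
  | Store q _ _ => [:: q]
  | Then p1 p2 | Ifte _ p1 p2 => written_arrs p1 ++ written_arrs p2
  | Loop _ p => written_arrs p
  | _ => [::]
  end.

Record state := State { reg : nat -> nat; arr : nat -> nat -> nat }.

Definition set_reg st r v : state := State (upd (reg st) r v) (arr st).
Definition set_arr st q j v : state :=
  State (reg st) (fun q' => if q' == q then upd (arr st q) j v else arr st q').

Definition agree_off (rs qs : seq nat) st st' : Prop :=
  (forall r, r \notin rs -> reg st' r = reg st r) /\
  (forall q, q \notin qs -> arr st' q = arr st q).

Definition unchanged p : state -> state -> Prop :=
  agree_off (written_regs p) (written_arrs p).

Lemma agree_off_refl rs qs st : agree_off rs qs st st.
Proof. by []. Qed.

Lemma agree_off_trans rs qs st1 st2 st3 :
  agree_off rs qs st1 st2 -> agree_off rs qs st2 st3 -> agree_off rs qs st1 st3.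
Proof.
by move=> [r12 a12] [r23 a23]; split=> [r rP|q qP]; rewrite ?r23 ?a23 ?r12 ?a12.
Qed.

Lemma agree_off_sub rs rs' qs qs' st st' : {subset rs <= rs'} -> {subset qs <= qs'} ->
  agree_off rs qs st st' -> agree_off rs' qs' st st'.
Proof.
move=> sub_rs sub_qs [rE aE]; split=> [r|q] notin.
  by apply: rE; apply: contra notin; apply: sub_rs.
by apply: aE; apply: contra notin; apply: sub_qs.
Qed.

Lemma unchanged_assign r x st v : unchanged (Assign r x) st (set_reg st r v).
Proof. by split=> //= r'; rewrite inE /upd => /negPf ->. Qed.

Lemma unchanged_then p1 p2 st1 st2 st3 :
  unchanged p1 st1 st2 -> unchanged p2 st2 st3 -> unchanged (Then p1 p2) st1 st3.
Proof.
move=> un1 un2; apply: (agree_off_trans (agree_off_sub _ _ un1) (agree_off_sub _ _ un2)) => r rP.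
all: by rewrite mem_cat rP ?orbT.
Qed.

Lemma upd_eq m i v : upd m i v i = v. Proof. by rewrite /upd eqxx. Qed.

Lemma upd_neq m i v j : j != i -> upd m i v j = m j.
Proof. by rewrite /upd => /negPf ->. Qed.

Record adequate w cap G inp : Prop := Adequate {
  adequate_constants : 1000 <= G;
  adequate_word : G <= 2 ^ w;
  adequate_memory : words cap <= G;
  adequate_input : forall j, nth 0 inp j < 2 ^ w }.

Section Semantics.
Variables (w cap G : nat) (inp : seq nat).
Local Notation s := (words cap).
Local Notation M := (2 ^ w).
Hypothesis ok : adequate w cap G inp.
Let G_ge : 1000 <= G := adequate_constants ok.
Let G_le : G <= M := adequate_word ok.
Let s_le : s <= G := adequate_memory ok.
Let inp_lt : forall j, nth 0 inp j < M := adequate_input ok.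
Implicit Types (m : Defs.mem) (st : state) (Q : state -> Prop) (p : prog).

Fixpoint eval st a : nat :=
  match a with
  | Reg r => reg st r
  | Cst v => v
  | Op o a b => binop_val o (eval st a) (eval st b)
  | Inp a => nth 0 inp (eval st a)
  | Arr q a => arr st q (eval st a)
  end.

Definition fits_word o x y : bool :=
  if o is (Add | Mul) then binop_val o x y < G else true.

Fixpoint safe st a : Prop :=
  match a with
  | Reg _ | Cst _ => True
  | Op o a b => [/\ safe st a, safe st b & fits_word o (eval st a) (eval st b)]
  | Inp a => safe st a
  | Arr _ a => safe st a /\ eval st a < cap
  end.

Definition bounded m : Prop := forall j, m j < M.

Definition represents m st : Prop :=
  [/\ bounded m, forall r, r < regs -> m (reg_addr r) = reg st r &
      forall q j, q < 4 -> j < cap -> m (arr_addr q j) = arr st q j].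

Definition same_data m m' : Prop := forall j, stack <= j -> m' j = m j.

Definition evaluates c d m v t : Prop := exists m',
  [/\ exec w s inp c m m' [::] t, m' d = v, bounded m' &
      forall j, (j < d) || (stack <= j) -> m' j = m j].

Lemma stack_lt d : d < stack -> d < s.
Proof. by rewrite /words; lia. Qed.

Lemma stack_ne d j : d < stack -> (j < d) || (stack <= j) -> j != d.
Proof. by lia. Qed.

Lemma bounded_upd m i v : bounded m -> v < M -> bounded (upd m i v).
Proof. by move=> bm vM j; rewrite /upd; case: eqP. Qed.

Lemma binop_lt o x y : x < M -> y < M ->
  fits_word o x y -> binop_val o x y < M.
Proof.
move=> xM yM; case: o => /=; try by move=> lt; apply: leq_trans lt G_le.
- by move=> _; apply: leq_ltn_trans xM; apply: leq_subr.
- by move=> _; apply: leq_ltn_trans xM; apply: leq_div.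
- by move=> _; apply: leq_ltn_trans xM; apply: leq_mod.
- by move=> _; apply: leq_ltn_trans (leq_b1 _) (leq_trans _ G_le); apply: leq_trans G_ge.
- by move=> _; apply: leq_ltn_trans (leq_b1 _) (leq_trans _ G_le); apply: leq_trans G_ge.
Qed.

Lemma represents_data m m' st :
  represents m st -> bounded m' -> same_data m m' -> represents m' st.
Proof.
move=> [_ regE arrE] bm' eq_m; split=> // [r rR|q j q4 jc].
  by rewrite eq_m ?regE // leq_addr.
by rewrite eq_m ?arrE // /arr_addr; lia.
Qed.

Lemma evaluates_const d v m :
  d < stack -> v < M -> bounded m -> evaluates (Const d v) d m v 1.
Proof.
move=> ds vM bm; exists (upd m d v); split; rewrite ?upd_eq //.
- by rewrite -{2}(modn_small vM); apply/ExecConst/stack_lt.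
- exact: bounded_upd.
- by move=> j jd; rewrite upd_neq // (stack_ne ds).
Qed.

Lemma evaluates_op o d ca cb m x y ta tb : d.+1 < stack ->
  evaluates ca d m x ta ->
  (forall m1, bounded m1 -> same_data m m1 -> evaluates cb d.+1 m1 y tb) ->
  (x < M -> y < M -> binop_val o x y < M) ->
  evaluates (compile_op o d ca cb) d m (binop_val o x y) (ta + (tb + 1)).
Proof.
move=> ds [m1 [ex1 m1d b1 eq_m1]] evb lt_val.
have [|m2 [ex2 m2d b2 eq_m2]] := evb m1 b1; first by move=> j js; rewrite eq_m1 ?js ?orbT.
have m2x : m2 d = x by rewrite eq_m2 ?ltnSn.
have {}lt_val : binop_val o x y < M by apply: lt_val; rewrite -?m2x -?m2d.
exists (upd m2 d (binop_val o x y)); split; rewrite ?upd_eq //.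
- apply: (ExecSeq (out1 := [::]) ex1); apply: (ExecSeq (out1 := [::]) ex2).
  rewrite -(modn_small lt_val) -m2x -m2d.
  by apply: ExecBin; apply: stack_lt; rewrite // ltnW.
- exact: bounded_upd.
- move=> j jd; rewrite upd_neq ?(stack_ne (ltnW ds)) // eq_m2 ?eq_m1 //.
  by case/orP: jd => [/ltnW|->]; rewrite ?ltnS ?orbT // => ->.
Qed.

Lemma evaluates_load c d m x t : d < stack -> evaluates c d m x t -> stack <= x < s ->
  evaluates (Seq c (LoadInd d d)) d m (m x) (t + 1).
Proof.
move=> ds [m1 [ex1 m1d b1 eq_m1]] /andP[sx xs].
exists (upd m1 d (m1 (m1 d))); split; rewrite ?upd_eq.
- apply: (ExecSeq (out1 := [::]) ex1); apply: ExecLoadInd; rewrite ?m1d //; exact: stack_lt.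
- by rewrite m1d eq_m1 ?sx ?orbT.
- exact: bounded_upd.
- by move=> j jd; rewrite upd_neq ?(stack_ne ds) // eq_m1.
Qed.

Lemma evaluates_read c d m x t : d < stack -> evaluates c d m x t ->
  evaluates (Seq c (Read d d)) d m (nth 0 inp x) (t + 1).
Proof.
move=> ds [m1 [ex1 m1d b1 eq_m1]].
exists (upd m1 d (nth 0 inp x)); split; rewrite ?upd_eq //.
- apply: (ExecSeq (out1 := [::]) ex1); rewrite -(modn_small (inp_lt x)) -m1d.
  by apply: ExecRead; apply: stack_lt.
- exact: bounded_upd.
- by move=> j jd; rewrite upd_neq ?(stack_ne ds) // eq_m1.
Qed.

Lemma arr_addr_bounds q j : q < 4 -> j < cap -> stack <= arr_addr q j < s.
Proof. by rewrite /arr_addr /words; lia. Qed.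

Lemma evaluates_addr q d c m j t : d.+1 < stack -> q < 4 -> j < cap ->
  bounded m -> evaluates c d m j t ->
  evaluates (compile_addr q d c) d m (arr_addr q j) (t + 4).
Proof.
move=> ds q4 jc bm evj; have /andP[_ lt_s] := arr_addr_bounds q4 jc.
have lt_M : arr_addr q j < M := leq_trans (leq_trans lt_s s_le) G_le.
have -> : t + 4 = (t + (1 + 1)) + (1 + 1) by lia.
have const_lt v : v < 1000 -> v < M by move=> v1; apply: leq_trans (leq_trans v1 G_ge) G_le.
have ltM : j * 4 < M by apply: leq_ltn_trans lt_M; apply: leq_addr.
apply: (@evaluates_op Add d _ _ _ (j * 4) (stack + regs + q)) => //; last first.
  by move=> m1 bm1 _; apply: evaluates_const => //; apply: const_lt; rewrite /stack /regs; lia.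
apply: (@evaluates_op Mul d _ _ _ j 4) => // m1 bm1 _.
by apply: evaluates_const => //; apply: const_lt.
Qed.

Lemma evaluates_expr a d m st : represents m st -> fits_stack d a -> safe st a ->
  evaluates (compile_expr a d) d m (eval st a) (cost a).
Proof.
elim: a d m => [r|v|o a IHa b IHb|a IHa|q a IHa] d m rep; have [bm regE arrE] := rep => /=.
- case/andP=> ds rR _; rewrite -regE //.
  have lt_s : stack <= reg_addr r < s by rewrite /reg_addr /words leq_addr /=; lia.
  apply: (@evaluates_load _ _ _ _ 1) => //; apply: evaluates_const => //.
  by case/andP: lt_s => _ /leq_trans/(_ s_le)/leq_trans/(_ G_le).
- case/andP=> ds v1000 _; apply: evaluates_const => //.
  exact: leq_trans (leq_trans v1000 G_ge) G_le.
- case/and3P=> ds fa fb [sa sb fits]; apply: evaluates_op => //; first exact: IHa.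
    by move=> m1 bm1 eq_m1; apply: IHb => //; apply: represents_data rep bm1 eq_m1.
  by move=> xM yM; apply: binop_lt.
- by case/andP=> ds fa sa; apply: evaluates_read => //; apply: IHa.
- case/and3P=> ds q4 fa [sa lt_cap]; rewrite -arrE //.
  have -> : cost a + 5 = (cost a + 4) + 1 by lia.
  apply: evaluates_load; [exact: ltnW | | exact: arr_addr_bounds].
  by apply: evaluates_addr => //; apply: IHa.
Qed.

(* The power of 5 pays for the search through all strings of digits. *)
Definition wp c p Q a st : Prop := forall m, represents m st ->
  exists m' t st', [/\ exec w s inp (compile p) m m' [::] t, t <= 5 ^ c * G ^ a,
    represents m' st', unchanged p st st' & Q st'].

Lemma time_gt0 c a : 0 < 5 ^ c * G ^ a.
Proof. by rewrite muln_gt0 !expn_gt0; apply/orP; left; apply: leq_trans G_ge. Qed.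

Lemma time_S c a t : t <= 1000 * (5 ^ c * G ^ a) -> t <= 5 ^ c * G ^ a.+1.
Proof. by move=> /leq_trans; apply; rewrite expnS [leqRHS]mulnCA leq_mul2r G_ge orbT. Qed.

Lemma time_const c a t : t <= 1000 -> t <= 5 ^ c * G ^ a.+1.
Proof. by move=> t1000; apply: time_S; apply: leq_trans t1000 (leq_pmulr _ (time_gt0 c a)). Qed.

Lemma time_le c c' a a' : c' <= c -> a' <= a -> 5 ^ c' * G ^ a' <= 5 ^ c * G ^ a.
Proof.
by move=> cc aa; rewrite leq_mul ?leq_pexp2l //; apply: leq_trans G_ge.
Qed.

Lemma wp_conseq c c' p Q Q' a a' st : wp c' p Q' a' st -> c' <= c -> a' <= a ->
  (forall st', unchanged p st st' -> Q' st' -> Q st') -> wp c p Q a st.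
Proof.
move=> wp_p cc aa QQ m rep; have [m' [t [st' [ex tB rep' un Q's]]]] := wp_p m rep.
exists m', t, st'; split=> //; last exact: QQ.
exact: leq_trans tB (time_le cc aa).
Qed.

Lemma wp_nop c Q a st : Q st -> wp c Nop Q a st.
Proof.
by move=> Qst m rep; exists m, 1, st; split=> //; [exact: ExecSkip | exact: time_gt0].
Qed.

Lemma exec_store c0 c1 m v x t0 t1 : evaluates c0 0 m v t0 ->
  (forall m1, bounded m1 -> same_data m m1 -> evaluates c1 1 m1 x t1) -> stack <= x < s ->
  exists m', [/\ exec w s inp (Seq c0 (Seq c1 (StoreInd 1 0))) m m' [::] (t0 + (t1 + 1)),
    bounded m' & forall j, stack <= j -> m' j = upd m x v j].
Proof.
move=> [m1 [ex1 m1v b1 eq_m1]] ev1 /andP[sx xs].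
have [|m2 [ex2 m2x b2 eq_m2]] := ev1 m1 b1; first by move=> j js; rewrite eq_m1 ?js ?orbT.
have m2v : m2 0 = v by rewrite eq_m2.
exists (upd m2 (m2 1) (m2 0)); split.
- apply: (ExecSeq (out1 := [::]) ex1); apply: (ExecSeq (out1 := [::]) ex2).
  by apply: ExecStoreInd; rewrite ?m2x //; apply: stack_lt.
- by apply: bounded_upd.
- by move=> j js; rewrite m2x m2v /upd; case: eqP => // _; rewrite eq_m2 ?eq_m1 ?js ?orbT.
Qed.

Lemma wp_assign c r x Q a st : (r < regs) && compilable 0 x -> safe st x ->
  Q (set_reg st r (eval st x)) -> wp c (Assign r x) Q a.+1 st.
Proof.
case/and3P=> rR fit_x cost_x sx Qst m rep; have [bm regE arrE] := rep.
have lt_s : stack <= reg_addr r < s by rewrite /reg_addr /words leq_addr /=; lia.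
have ev_addr m1 : bounded m1 -> same_data m m1 ->
    evaluates (Const 1 (reg_addr r)) 1 m1 (reg_addr r) 1.
  move=> bm1 _; apply: evaluates_const => //.
  by case/andP: lt_s => _ /leq_trans/(_ s_le)/leq_trans/(_ G_le).
have [m' [ex bm' m'E]] := exec_store (evaluates_expr rep fit_x sx) ev_addr lt_s.
exists m', (cost x + (1 + 1)), (set_reg st r (eval st x)); split=> //.
- by apply: time_const; lia.
- split=> // [r' r'R|q j q4 jc]; rewrite m'E ?leq_addr //.
  + by rewrite /= /upd eqn_add2l -regE.
  + by rewrite upd_neq ?arrE // /arr_addr /reg_addr; lia.
  + by rewrite /arr_addr; lia.
- exact: unchanged_assign.
Qed.

Lemma wp_store c q l x Q a st : [&& q < 4, compilable 1 l & compilable 0 x] ->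
  safe st l -> safe st x -> eval st l < cap ->
  Q (set_arr st q (eval st l) (eval st x)) -> wp c (Store q l x) Q a.+1 st.
Proof.
case/and3P=> q4 /andP[fit_l cost_l] /andP[fit_x cost_x] sl sx lc Qst m rep.
have [bm regE arrE] := rep.
have ev_addr m1 : bounded m1 -> same_data m m1 ->
    evaluates (compile_addr q 1 (compile_expr l 1)) 1 m1 (arr_addr q (eval st l)) (cost l + 4).
  move=> bm1 eq_m1; apply: evaluates_addr => //.
  exact: evaluates_expr (represents_data rep bm1 eq_m1) fit_l sl.
have [m' [ex bm' m'E]] :=
  exec_store (evaluates_expr rep fit_x sx) ev_addr (arr_addr_bounds q4 lc).
exists m', (cost x + ((cost l + 4) + 1)), (set_arr st q (eval st l) (eval st x)); split=> //.
- by apply: time_const; lia.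
- split=> // [r' r'R|q' j q'4 jc]; rewrite m'E ?leq_addr //.
  + by rewrite upd_neq ?regE // /arr_addr /reg_addr; lia.
  + have -> : upd m (arr_addr q (eval st l)) (eval st x) (arr_addr q' j) =
        if (q' == q) && (j == eval st l) then eval st x else m (arr_addr q' j).
      by rewrite /upd; congr (if _ then _ else _); rewrite /arr_addr; lia.
    by rewrite /= /upd; case: (q' =P q) => [->|_] /=; rewrite arrE.
  + by rewrite /arr_addr; lia.
- by split=> //= q'; rewrite inE => /negPf ->.
Qed.

Lemma wp_then c p1 p2 Q a st :
  wp c p1 (wp c p2 Q a) a st -> wp c (Then p1 p2) Q a.+1 st.
Proof.
move=> wp1 m rep; have [m1 [t1 [st1 [ex1 tB1 rep1 un1 wp2]]]] := wp1 m rep.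
have [m2 [t2 [st2 [ex2 tB2 rep2 un2 Qst2]]]] := wp2 m1 rep1.
exists m2, (t1 + t2), st2; split=> //.
- exact: (ExecSeq ex1 ex2).
- by apply: time_S; apply: leq_trans (leq_add tB1 tB2) _; rewrite addnn -mul2n leq_mul2r orbT.
- exact: unchanged_then un1 un2.
Qed.

Lemma wp_ifte c x p1 p2 Q a st : compilable 0 x -> safe st x ->
  (eval st x != 0 -> wp c p1 Q a st) -> (eval st x = 0 -> wp c p2 Q a st) ->
  wp c (Ifte x p1 p2) Q a.+1 st.
Proof.
case/andP=> fit_x cost_x sx wp1 wp2 m rep.
have [m1 [ex1 m1x bm1 eq_m1]] := evaluates_expr rep fit_x sx.
have rep1 : represents m1 st by apply: represents_data rep bm1 _ => j js; rewrite eq_m1 ?js ?orbT.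
pose p := if eval st x != 0 then p1 else p2.
have [|m2 [t [st2 [ex2 tB rep2 un2 Qst2]]]] := (_ : wp c p Q a st) m1 rep1.
  by rewrite /p; case: eqVneq => [/wp2|/wp1].
exists m2, (cost x + t.+1), st2; split=> //.
- apply: (ExecSeq (out1 := [::]) ex1); apply: ExecIf; first exact: stack_lt.
  by rewrite m1x; move: ex2; rewrite /p; case: ifP.
- by apply: time_S; have := time_gt0 c a; lia.
- apply: agree_off_sub un2; rewrite /p /=; case: ifP => _ r rP; by rewrite mem_cat rP ?orbT.
Qed.

Lemma wp_loop c c' r p Q a b (I : nat -> state -> Prop) j st : r < regs ->
  (forall st', I 0 st' -> reg st' r = 0) ->
  (forall i st', unchanged p st st' -> I i.+1 st' -> reg st' r != 0 ->
     wp c' p (fun st'' => exists2 i', i' <= i & I i' st'') b st') ->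
  (forall i st', unchanged p st st' -> I i st' -> reg st' r = 0 -> Q st') ->
  I j st -> j * (5 ^ c' * G ^ b).+1 < 5 ^ c * G ^ a -> wp c (Loop r p) Q a st.
Proof.
move=> rR I0 body IQ Ij lt_time m rep.
have rs : reg_addr r < s by rewrite /reg_addr /words; lia.
have loop N : forall i st1 m1, i < N -> unchanged p st st1 -> I i st1 -> represents m1 st1 ->
    exists m' t st', [/\ exec w s inp (compile (Loop r p)) m1 m' [::] t,
      t <= (i * (5 ^ c' * G ^ b).+1).+1, represents m' st', unchanged p st st' & Q st'].
  elim: N => // N IHN i st1 m1 lt_N un1 Ii rep1; have [_ regE _] := rep1.
  have [r0|r0] := eqVneq (reg st1 r) 0.
    exists m1, 1, st1; split=> //; last exact: IQ un1 Ii r0.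
    by apply: ExecWhileStop; rewrite // regE.
  case: i lt_N Ii => [|i] lt_N Ii; first by rewrite I0 in r0.
  have [m2 [t2 [st2 [ex2 tB2 rep2 un2 [i' le_i' I']]]]] := body i st1 un1 Ii r0 m1 rep1.
  have [||m3 [t3 [st3 [ex3 tB3 rep3 un3 Qst3]]]] := IHN i' st2 m2 _ _ I' rep2.
  - exact: leq_ltn_trans le_i' lt_N.
  - exact: agree_off_trans un1 un2.
  exists m3, (t2 + t3).+1, st3; split=> //.
  - by apply: (ExecWhileLoop (out1 := [::]) rs _ ex2 ex3); rewrite regE.
  - have : i' * (5 ^ c' * G ^ b).+1 <= i * (5 ^ c' * G ^ b).+1 by rewrite leq_mul2r le_i' orbT.
    by rewrite mulSn; lia.
have [m' [t [st' [ex tB rep' un Qst]]]] := loop _ j st m (ltnSn j) (agree_off_refl _ _ st) Ij rep.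
by exists m', t, st'; split=> //; apply: leq_trans tB lt_time.
Qed.

Definition For r x p : prog :=
  Then (Assign r x) (Loop r (Then (Assign r (Op Defs.Sub (Reg r) (Cst 1))) p)).

Lemma wp_for (A : Type) (f : nat -> A -> A) (R : nat -> A -> state -> Prop) y0 N
    c r x p Q a st :
  [&& r < regs, compilable 0 x & r \notin written_regs p] ->
  safe st x -> eval st x = N -> N <= G -> R N y0 (set_reg st r N) ->
  (forall j y st', j < N -> unchanged (For r x p) st st' -> R j.+1 y st' ->
     wp c p (R j (f j y)) a (set_reg st' r j)) ->
  (forall st', unchanged (For r x p) st st' -> R 0 (foldr f y0 (iota 0 N)) st' -> Q st') ->
  wp c (For r x p) Q (5 + a) st.
Proof.
case/and3P=> rR cx rp sx xN NG RN body final.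
apply: wp_then; apply: wp_assign => //; first exact/andP; rewrite xN.
pose body_p := Then (Assign r (Op Defs.Sub (Reg r) (Cst 1))) p.
have un_for st' : unchanged body_p (set_reg st r N) st' -> unchanged (For r x p) st st'.
  by apply: unchanged_then (unchanged_assign r x st N).
apply: (@wp_loop c c _ _ _ a.+4 a.+2 (fun j st' => [/\ j <= N, reg st' r = j &
    exists2 y, R j y st' & foldr f y (iota 0 j) = foldr f y0 (iota 0 N)]) N) => //.
- by move=> st' [].
- move=> j st' /un_for un [jN rj [y Ry fold_y]] _.
  apply: wp_then; apply: wp_assign => //; first by rewrite rR /compilable /= rR.
  rewrite /= rj subn1 /=; apply: wp_conseq (body j y st' jN un Ry) _ _ _ => // st'' [un'' _] Rj.
  exists j => //; split; [exact: ltnW | by rewrite un'' //= upd_eq |].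
  by exists (f j y); rewrite // -fold_y foldr_iotaS.
- move=> j st' /un_for un [_ rj [y Ry fold_y]] r0; move: Ry fold_y.
  by rewrite -rj r0 /= => Ry fold_y; apply: final; rewrite // -fold_y.
- by split; rewrite //= ?upd_eq //; exists y0.
- set X := 5 ^ c * G ^ a.+2; have -> : 5 ^ c * G ^ a.+4 = G * G * X.
    by rewrite /X [RHS]mulnCA -[G * G]/(G ^ 2) -expnD.
  apply: leq_ltn_trans (leq_mul NG (leqnn _)) _.
  rewrite -mulnA ltn_pmul2l; last exact: leq_trans G_ge.
  by have := time_gt0 c a.+2; have := leq_mul G_ge (leqnn X); rewrite -/X; lia.
Qed.

Definition Any flag r x p b : prog :=
  Then (Assign flag (Cst 0)) (For r x (Then p (Ifte b (Assign flag (Cst 1)) Nop))).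

Lemma wp_any (R : nat -> state -> Prop) (P : pred nat) N c flag r x p b Q a st :
  [&& flag < regs, r < regs, compilable 0 x, compilable 0 b, flag != r,
      r \notin written_regs p & flag \notin written_regs p] ->
  let st0 := set_reg st flag 0 in
  safe st0 x -> eval st0 x = N -> N <= G -> R N (set_reg st0 r N) ->
  (forall j st', R j st' -> R j (set_reg st' flag 1)) ->
  (forall j st', j < N -> unchanged (Any flag r x p b) st st' -> R j.+1 st' ->
     wp c p (fun st'' => [/\ R j st'', safe st'' b & (eval st'' b != 0) = P j]) a
       (set_reg st' r j)) ->
  (forall st', unchanged (Any flag r x p b) st st' -> R 0 st' ->
     reg st' flag = has P (iota 0 N) -> Q st') ->
  wp c (Any flag r x p b) Q (9 + a) st.
Proof.
case/and5P=> flagR rR cx cb /and3P[flag_r rp flagp] st0 sx xN NG RN R_flag body final.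
apply: wp_then; apply: wp_assign => //; rewrite ?flagR //=.
have un_any st' : unchanged (For r x (Then p (Ifte b (Assign flag (Cst 1)) Nop))) st0 st' ->
    unchanged (Any flag r x p b) st st'.
  by apply: unchanged_then (unchanged_assign flag (Cst 0) st 0).
apply: (@wp_for bool (fun j found => P j || found)
  (fun j found st' => R j st' /\ reg st' flag = found) false N) => //.
- by rewrite rR cx /= !mem_cat !inE negb_or rp eq_sym flag_r.
- by split; rewrite //= upd_neq // upd_eq.
- move=> j found st' jN /un_any un [Rj flagE]; apply: wp_then.
  apply: wp_conseq (body j st' jN un Rj) (leqnn c) (leq_addl 2 a) _ => st'' [un'' _] [R'' sb bP].
  have flagE'' : reg st'' flag = found by rewrite un'' //= upd_neq.
  apply: wp_ifte; rewrite ?cb // => bE; rewrite bE in bP.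
  + apply: wp_assign; rewrite ?flagR //=; split; first exact: R_flag.
    by rewrite upd_eq -bP.
  + by apply: wp_nop; rewrite -bP.
- move=> st' /un_any un [R0 flagE]; exact: final.
Qed.

Definition Fill q r x v : prog := For r x (Store q (Reg r) v).

Lemma wp_fill (f : nat -> nat) N c q r x v Q a st :
  [&& r < regs, q < 4, compilable 0 x & compilable 0 v] ->
  safe st x -> eval st x = N -> N <= G -> N <= cap ->
  (forall j st', j < N -> unchanged (Fill q r x v) st st' ->
     safe (set_reg st' r j) v /\ eval (set_reg st' r j) v = f j) ->
  (forall st', unchanged (Fill q r x v) st st' ->
     (forall j, j < N -> arr st' q j = f j) -> Q st') ->
  wp c (Fill q r x v) Q (6 + a) st.
Proof.
case/and4P=> rR q4 cx cv sx xN NG N_cap vP final.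
apply: (@wp_for unit (fun _ u => u)
  (fun j _ st' => forall i, j <= i < N -> arr st' q i = f i) tt N) => //.
- by rewrite rR cx.
- by move=> i; lia.
- move=> j _ st' jN un filled; have [sv vE] := vP j st' jN un.
  apply: wp_store; rewrite //= ?q4 ?cv ?upd_eq //; first by rewrite /compilable /= rR.
    exact: leq_trans jN N_cap.
  move=> i /andP[ji iN]; rewrite /= eqxx vE /upd; case: eqP => [->//|/eqP nij].
  by apply: filled; rewrite iN andbT ltn_neqAle eq_sym nij.
Qed.

Definition state0 : state := State (fun=> 0) (fun _ _ => 0).

Lemma wp_exec c p r Q a : r < regs -> wp c p Q a state0 ->
  exists2 st, Q st & exists2 t, t <= (5 ^ c * G ^ a).+1 &
    runs w s (Seq (compile p) (Write (reg_addr r))) inp [:: reg st r] t.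
Proof.
move=> rR; case/(_ (fun=> 0)); first by split=> // j; rewrite expn_gt0.
move=> m' [t [st' [ex tB [_ regE _] _ Q_st']]]; exists st' => //.
exists (t + 1); first by rewrite addn1.
exists m'; rewrite -regE //; apply: (ExecSeq (out1 := [::]) ex).
by apply: ExecWrite; rewrite /reg_addr /words; lia.
Qed.

End Semantics.

(** * The program *)

Declare Scope prog_scope.
Delimit Scope prog_scope with prog.
Bind Scope prog_scope with expr prog.
Notation "a + b" := (Op Defs.Add a b) : prog_scope.
Notation "a - b" := (Op Defs.Sub a b) : prog_scope.
Notation "a * b" := (Op Defs.Mul a b) : prog_scope.
Notation "a %/ b" := (Op Defs.Div a b) : prog_scope.
Notation "a %% b" := (Op Defs.Mod a b) : prog_scope.
Notation "a == b" := (Op Defs.Eq a b) : prog_scope.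
Notation "a < b" := (Op Defs.Lt a b) : prog_scope.
Notation "# r" := (Reg r) (at level 1, format "# r") : prog_scope.
Notation "$ v" := (Cst v) (at level 1, format "$ v") : prog_scope.
Notation "r <- a" := (Assign r a) (at level 75) : prog_scope.
Notation "p1 ;; p2" := (Then p1 p2) (at level 80, right associativity) : prog_scope.
(* On the truth values 0 and 1, truncated subtraction gives the connectives. *)
Notation "~~ a" := ($1 - a)%prog : prog_scope.
Notation "a && b" := (a - ~~ b)%prog : prog_scope.

Notation aRoots := 0 (only parsing).
Notation aDigits := 1 (only parsing).
Notation aDeleted := 2 (only parsing).
Notation aBits := 3 (only parsing).

Notation rVertex := 0 (only parsing).
Notation rFound := 1 (only parsing).
Notation rSlot := 2 (only parsing).
Notation rOldArg := 3 (only parsing).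
Notation rOldRes := 4 (only parsing).
Notation rOldPrev := 5 (only parsing).
Notation rOldCur := 6 (only parsing).
Notation rTime := 10 (only parsing).
Notation rTick := 11 (only parsing).
Notation rPos := 12 (only parsing).
Notation rVisArg := 13 (only parsing).
Notation rVisTime := 14 (only parsing).
Notation rVisRes := 15 (only parsing).
Notation rLiveArg := 16 (only parsing).
Notation rLiveRes := 17 (only parsing).
Notation rLivePrev := 18 (only parsing).
Notation rLiveCur := 19 (only parsing).
Notation rTest := 23 (only parsing).
Notation rNbr := 24 (only parsing).
Notation rHit := 25 (only parsing).
Notation rStep := 26 (only parsing).
Notation rCenter := 27 (only parsing).
Notation rLinked := 28 (only parsing).
Notation rIdx := 29 (only parsing).
Notation rItem := 30 (only parsing).
Notation rLim := 31 (only parsing).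
Notation rBnd := 32 (only parsing).
Notation rCnt := 33 (only parsing).
Notation rUsed := 34 (only parsing).
Notation rBits := 35 (only parsing).
Notation rBad := 36 (only parsing).
Notation rRootTest := 37 (only parsing).
Notation rN := 40 (only parsing).
Notation rK := 41 (only parsing).
Notation rI := 42 (only parsing).
Notation rFailed := 43 (only parsing).
Notation rRound := 44 (only parsing).
Notation rAnswer := 45 (only parsing).
Notation rSearching := 50 (only parsing).
Notation rSolved := 51 (only parsing).
Notation rDigit := 52 (only parsing).
Notation rCarry := 53 (only parsing).
Notation rSucc := 54 (only parsing).
Notation rPow := 55 (only parsing).
Notation rPtr := 56 (only parsing).
Notation rBit := 57 (only parsing).
Notation rBitIdx := 58 (only parsing).

Definition edge u v : expr := Inp ($1 + (u * #rN + v)).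
Definition slots : expr := #rK * $2 + $2.
Definition tour : expr := #rN * #rN + $1.

Definition mem_array q : prog :=
  Any rFound rSlot slots Nop (Arr q #rSlot == #rVertex + $1).

Definition mem_old : prog :=
  rVertex <- #rOldArg ;; mem_array aRoots ;; rOldRes <- (#rOldArg < #rI) && ~~ #rFound.

(* The register [b.+1] holds the current vertex of the walk and [b] the previous one. *)
Definition scan_nbr b (mem_prog : prog) arg res : prog :=
  b.+4 <- (#b + #(b.+2) + $1) %% #rN ;;
  Ifte (edge #(b.+1) #(b.+4))
    (arg <- #(b.+4) ;; mem_prog ;; Ifte #res (b.+3 <- #(b.+4)) Nop)
    Nop.

Definition step_walk b mem_prog arg res : prog :=
  b.+3 <- #(b.+1) ;;
  For b.+2 #rN (scan_nbr b mem_prog arg res) ;;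
  b <- #(b.+1) ;;
  b.+1 <- #(b.+3).

Definition step_old : prog := step_walk rOldPrev mem_old rOldArg rOldRes.

Definition position : prog :=
  rOldPrev <- #rTime %/ tour ;;
  rOldCur <- #rOldPrev ;;
  For rTick (#rTime %% tour) step_old ;;
  rOldArg <- #rTime %/ tour ;;
  mem_old ;;
  Ifte #rOldRes (rPos <- #rOldCur) (rPos <- #rN).

Definition mem_visited_prog : prog :=
  Any rVisRes rVisTime #rLim (rTime <- #rVisTime ;; position) (#rPos == #rVisArg).

Definition mem_live : prog :=
  rVertex <- #rLiveArg ;; mem_array aDeleted ;;
  rLiveRes <- (#rLiveArg < #rBnd) && ~~ #rFound ;;
  rVisArg <- #rLiveArg ;; mem_visited_prog ;;
  rLiveRes <- #rLiveRes && ~~ #rVisRes.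

Definition step_live : prog := step_walk rLivePrev mem_live rLiveArg rLiveRes.

Definition link_test : prog :=
  Ifte #rRootTest
    (rVertex <- #rLiveCur ;; mem_array aRoots ;; rTest <- #rFound)
    (rTest <- (~~ (#rLiveCur == #rNbr)) && edge #rCenter #rLiveCur).

Definition walk_hits_prog : prog :=
  rLivePrev <- #rNbr ;; rLiveCur <- #rNbr ;;
  Any rHit rStep tour (link_test ;; step_live) #rTest.

Definition count_nbr : prog :=
  Ifte (edge #rCenter #rNbr) (
    rLiveArg <- #rNbr ;; mem_live ;;
    Ifte #rLiveRes (walk_hits_prog ;; rLinked <- #rHit + #rLinked) Nop)
  Nop.

Definition count_linked : prog := rLinked <- $0 ;; For rNbr #rN count_nbr.

Definition push x : prog :=
  Ifte (#rCnt < #rK) (Store aDeleted #rCnt x ;; rCnt <- #rCnt + $1) Nop.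

Definition append_bits : prog :=
  Store aBits #rBits ((#rItem - $1) %% $2) ;;
  Store aBits (#rBits + $1) ((#rItem - $1) %/ $2) ;;
  rBits <- #rBits + $2.

Definition read_digits : prog :=
  rCnt <- $0 ;; rBits <- $0 ;;
  For rIdx (#rK + $1) (
    rItem <- Arr aDigits #rIdx ;;
    Ifte #rItem append_bits (push (Arr aRoots #rIdx))).

Definition guess_vertex : prog :=
  rLim <- #rIdx + $1 ;; rCenter <- #rItem ;; rRootTest <- $1 ;; count_linked ;;
  Ifte (($1 < #rLinked) && (#rUsed < slots))
    (rItem <- #rItem + $1 ;; Ifte (Arr aBits #rUsed) (push #rItem) Nop ;;
     rUsed <- #rUsed + $1)
    Nop.

Definition visit_position : prog :=
  rTime <- #rIdx ;; position ;; rItem <- #rPos ;;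
  Ifte (#rItem < #rN)
    (rLim <- #rIdx ;; rVisArg <- #rItem ;; mem_visited_prog ;; Ifte #rVisRes Nop guess_vertex)
    Nop.

Definition guess_all : prog :=
  rBnd <- #rI ;; rUsed <- $0 ;; For rIdx (#rN * tour) visit_position.

Definition build_candidate : prog :=
  Fill aDeleted rIdx slots $0 ;; Fill aBits rIdx slots $0 ;; read_digits ;; guess_all.

Definition check_vertex_prog : prog :=
  rLinked <- $0 ;; rVertex <- #rIdx ;; mem_array aDeleted ;;
  Ifte #rFound Nop (rBnd <- #rIdx ;; rCenter <- #rIdx ;; count_linked).

Definition check_prog : prog :=
  rLim <- $0 ;; rRootTest <- $0 ;; Any rBad rIdx #rI check_vertex_prog #rLinked.

Definition next_digit : prog :=
  Ifte #rCarry
    (rSucc <- Arr aDigits #rDigit + $1 ;;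
     Ifte (#rSucc == $5)
       (Store aDigits #rDigit $0)
       (Store aDigits #rDigit #rSucc ;; rCarry <- $0))
    Nop.

Definition next_digits : prog := rCarry <- $1 ;; For rDigit (#rK + $1) next_digit.

Definition try_digits : prog :=
  build_candidate ;; check_prog ;;
  Ifte #rBad (next_digits ;; rSearching <- ~~ #rCarry) (rSolved <- $1 ;; rSearching <- $0).

Definition search : prog :=
  rSolved <- $0 ;; rSearching <- $1 ;; Fill aDigits rDigit (#rK + $1) $0 ;;
  Loop rSearching try_digits.

Definition add_vertex : prog :=
  rI <- #rN - #rRound ;; Store aRoots #rK #rI ;; search ;;
  Ifte #rSolved (Fill aRoots rDigit slots (Arr aDeleted #rDigit)) (rFailed <- $1).

Definition compression : prog :=
  rFailed <- $0 ;; For rRound #rN (Ifte #rFailed Nop add_vertex) ;; rAnswer <- ~~ #rFailed.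

Arguments upd m i v j /.

Ltac state_simpl := rewrite /=; repeat first
  [ rewrite upd_eq
  | rewrite upd_neq; [|by []]
  | match goal with un : unchanged ?p ?st ?st' |- context [reg ?st' ?r] =>
      rewrite (un.1 r isT) /= end
  | match goal with un : unchanged ?p ?st ?st' |- context [arr ?st' ?q] =>
      rewrite (un.2 q isT) /= end ].

Ltac safety := state_simpl; repeat split; try done; try lia.

Lemma reg_set_eq st r v : reg (set_reg st r v) r = v.
Proof. by rewrite /= eqxx. Qed.

Lemma reg_set_neq st r r' v : r' != r -> reg (set_reg st r v) r' = reg st r'.
Proof. by move=> /= /negPf ->. Qed.

Definition answers (P : Prop) st : Prop :=
  exists2 ans : bool, reg st rAnswer = ans & (ans <-> P).

Definition encodes cap (f : nat -> nat) (l : seq nat) : Prop :=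
  forall j, j < cap -> f j = nth 0 l j.

Lemma encodes_mem cap f l x : size l <= cap -> encodes cap f l ->
  has (fun j => f j == x.+1) (iota 0 cap) = (x.+1 \in l).
Proof.
move=> l_cap fE; apply/hasP/idP => [[j]|xl].
  rewrite mem_iota /= => jc; rewrite fE // => /eqP jE; rewrite -jE mem_nth // ltnNge.
  by apply: contra_eqN jE => jl; rewrite nth_default.
have lt : index x.+1 l < cap by apply: leq_trans l_cap; rewrite index_mem.
by exists (index x.+1 l); rewrite ?mem_iota ?fE ?nth_index.
Qed.

Lemma encodes_upd_size cap f l x :
  encodes cap f l -> encodes cap (upd f (size l) x) (rcons l x).
Proof.
move=> fE j jc; rewrite /upd nth_rcons; case: ltngtP => // lt; rewrite fE //.
by rewrite nth_default // ltnW.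
Qed.

Lemma and_notE (b c : bool) : b - (1 - (1 - c)) = b && ~~ c.
Proof. by case: b; case: c. Qed.

Lemma foldr_iter (A I : Type) (f : A -> A) x (s : seq I) :
  foldr (fun=> f) x s = iter (size s) f x.
Proof. by elim: s => //= i s ->. Qed.

Lemma has_iota_rev (P : pred nat) N :
  has (fun j => P (N - j.+1)) (iota 0 N) = has P (iota 0 N).
Proof.
apply/hasP/hasP => -[j]; rewrite mem_iota /= => jN Pj; exists (N - j.+1) => //.
- by rewrite mem_iota subnSK // leq_subr.
- by rewrite mem_iota subnSK // leq_subr.
- by rewrite subnSK // subKn // ltnW.
Qed.

Lemma oapp_val_eq n (o : option 'I_n) (x : 'I_n) : (oapp val n o == x) = (o == Some x).
Proof.
case: o => [y|] /=; first by rewrite (inj_eq Some_inj).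
by rewrite eq_sym ltn_eqF.
Qed.

Lemma row_major_lt n (u v : 'I_n) : u * n + v < n * n.
Proof.
apply: (@leq_trans (u.+1 * n)); first by rewrite mulSn [n + _]addnC ltn_add2l.
by rewrite leq_mul2r ltn_ord orbT.
Qed.

Lemma succ_digit_carry V d : 0 < d -> d %| V.+1 ->
  V.+1 %/ d %% 5 = (if V %/ d %% 5 + 1 == 5 then 0 else V %/ d %% 5 + 1) /\
  (5 * d %| V.+1) = (V %/ d %% 5 + 1 == 5).
Proof.
move=> d0 dV; have E := divnS V d0; rewrite dV in E.
split; first by rewrite E; move: (V %/ d) => q; case: ifP; lia.
by rewrite -[in LHS](divnK dV) dvdn_pmul2r // E; move: (V %/ d) => q; lia.
Qed.

Lemma succ_digit_nocarry V d : 0 < d -> (d %| V.+1) = false ->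
  V.+1 %/ d = V %/ d /\ (5 * d %| V.+1) = false.
Proof.
move=> d0 dV; rewrite (divnS V d0) dV; split=> //.
by apply: contraFF dV; apply: dvdn_trans; apply: dvdn_mull.
Qed.

Lemma exists_base5 (x : nat -> nat) m : (forall j, x j < 5) ->
  exists2 V, V < 5 ^ m & forall l, l < m -> V %/ 5 ^ l %% 5 = x l.
Proof.
move=> x5; elim: m => [|m [V V_lt VE]]; first by exists 0.
exists (x m * 5 ^ m + V).
  rewrite expnS; apply: (@leq_trans ((x m).+1 * 5 ^ m)).
    by rewrite mulSn [ltnRHS]addnC ltn_add2l.
  by rewrite leq_mul2r x5 orbT.
move=> l; rewrite ltnS leq_eqVlt => /orP[/eqP ->|lm].
  by rewrite divnMDl ?expn_gt0 // divn_small // addn0 modn_small.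
have -> : 5 ^ m = 5 ^ (m - l).-1 * 5 * 5 ^ l.
  by rewrite -expnSr prednK ?subn_gt0 // -expnD subnK // ltnW.
by rewrite mulnA divnMDl ?expn_gt0 // mulnA modnMDl VE.
Qed.

Section WordBound.
Variables n G : nat.
Hypothesis G_ge : 1000 * (n.+1 * n.+1 * n.+1) <= G.

Lemma G_ge_sqr : 1000 * (n.+1 * n.+1) <= G.
Proof. by apply: leq_trans G_ge; rewrite leq_mul2l leq_pmulr. Qed.

Lemma G_ge_linear : 1000 * n.+1 <= G.
Proof. by apply: leq_trans G_ge_sqr; rewrite leq_mul2l leq_pmulr. Qed.

Lemma G_ge1000 : 1000 <= G.
Proof. by apply: leq_trans G_ge_linear; rewrite leq_pmulr. Qed.

Lemma pow_G_lt a : (G ^ a).+1 < G ^ a.+1.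
Proof.
have := leq_mul (leq_trans (isT : 3 <= 1000) G_ge1000) (leqnn (G ^ a)).
have : 0 < G ^ a by rewrite expn_gt0; apply/orP; left; apply: leq_trans G_ge1000.
by rewrite expnS; lia.
Qed.

End WordBound.

Section Programs.
Variables (w G : nat) (inp : seq nat) (n' k : nat).
Local Notation n := n'.+1.
Local Notation cap := k.*2.+2.
Variable e : rel 'I_n.
Hypothesis G_ge : 1000 * (n.+1 * n.+1 * n.+1) <= G.
Hypothesis ok : adequate w cap G inp.
Hypothesis inp_adj : forall u v : 'I_n, nth 0 inp (1 + (u * n + v)) = e u v.
Implicit Types st : state.

Let sqr_le_G : 1000 * (n.+1 * n.+1) <= G := G_ge_sqr G_ge.
Let n_le_G : 1000 * n.+1 <= G := G_ge_linear G_ge.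

Let words_le_G : stack + regs + 4 * cap <= G := adequate_memory ok.

Lemma cap_le_G : cap <= G.
Proof. by lia. Qed.

Local Notation wp := (wp w cap G inp).

Local Notation assignP := (wp_assign ok).
Local Notation storeP := (wp_store ok).
Local Notation ifteP := (wp_ifte ok).
Local Notation thenP := (wp_then ok).
Local Notation callP := (wp_conseq ok).
Local Notation nopP := (wp_nop ok).
Local Notation loopP := (wp_loop ok).
Local Notation forP := (wp_for ok).
Local Notation anyP := (wp_any ok).
Local Notation fillP := (wp_fill ok).

Lemma slots_safe st : reg st rK = k -> safe cap G inp st slots /\ eval inp st slots = cap.
Proof. by move=> rKE; rewrite /= /fits_word /= rKE; split; safety. Qed.

Lemma mem_array_spec q l st : q < 4 -> size l <= cap -> reg st rK = k ->
  encodes cap (arr st q) l -> reg st rVertex < n ->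
  wp 0 (mem_array q) (fun st' => reg st' rFound = ((reg st rVertex).+1 \in l)) 9 st.
Proof.
move=> q4 l_cap rKE arrE u_lt.
have [safe_slots slotsE] := slots_safe (st := set_reg st rFound 0) rKE.
apply: (anyP (R := fun _ _ => True) (N := cap)
  (P := fun j => arr st q j == (reg st rVertex).+1)) => //.
- by rewrite /compilable /= q4.
- exact: cap_le_G.
- move=> j st' jc un _; apply: nopP; split=> //.
    by safety.
  by state_simpl; rewrite addn1 eqb0 negbK.
- by move=> st' _ _ ->; rewrite -(encodes_mem _ l_cap arrE).
Qed.

Record instance i wl sl st : Prop := Instance {
  inst_n : reg st rN = n;
  inst_k : reg st rK = k;
  inst_i : reg st rI = i;
  inst_roots : encodes cap (arr st aRoots) wl;
  inst_deleted : encodes cap (arr st aDeleted) sl }.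

Ltac instances := match goal with inst : instance _ _ _ _ |- _ =>
  by case: inst => ? ? ? ? ?; split; state_simpl end.

Lemma mem_old_spec i wl sl st (x : 'I_n) : instance i wl sl st -> size wl <= cap ->
  reg st rOldArg = x ->
  wp 0 mem_old (fun st' => reg st' rOldRes = (x \in old_graph i wl)) 11 st.
Proof.
move=> inst wl_cap xE; have [_ rKE rIE rootsE _] := inst.
apply: thenP; apply: assignP => //; apply: thenP; rewrite /= xE.
apply: callP (@mem_array_spec aRoots wl _ _ _ _ _ _) _ _ _ => //=.
move=> st' un foundE; apply: assignP; rewrite //=.
by state_simpl; rewrite foundE rIE xE and_notE in_setD in_vset in_below andbC.
Qed.

Lemma edge_safe st x y (u v : 'I_n) : reg st rN = n -> eval inp st x = u -> eval inp st y = v ->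
  safe cap G inp st x -> safe cap G inp st y ->
  safe cap G inp st (edge x y) /\ eval inp st (edge x y) = e u v.
Proof.
move=> rNE xE yE sx sy; rewrite /= /fits_word /= rNE xE yE inp_adj; split=> //.
by have := row_major_lt u v; do !split=> //; lia.
Qed.

Section StepWalk.
Variables (b arg res a : nat) (mem_prog : prog) (Inv : state -> Prop) (Z : {set 'I_n}).
Hypotheses (arg_lt : arg < b) (res_lt : res < b) (b_lt : b.+4 < 40).
Hypothesis mem_regs : forall r, b <= r -> r \notin written_regs mem_prog.
Hypothesis mem_arrs : written_arrs mem_prog = [::].
Hypothesis Inv_agree : forall st st', (forall r, b.+4 < r -> reg st' r = reg st r) ->
  arr st' =1 arr st -> Inv st -> Inv st'.
Hypothesis Inv_n : forall st, Inv st -> reg st rN = n.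
Hypothesis mem_prog_spec : forall st (x : 'I_n), Inv st -> reg st arg = x ->
  wp 0 mem_prog (fun st' => reg st' res = (x \in Z)) a st.

Ltac reg_simpl := repeat first [rewrite reg_set_eq | rewrite reg_set_neq; last by lia].

Definition scan (p c : 'I_n) q (acc : 'I_n) :=
  if e c (rotate p q) && (rotate p q \in Z) then rotate p q else acc.

Lemma step_walk_scan st (p c acc : 'I_n) q : Inv st -> q < n ->
  reg st b = p -> reg st b.+1 = c -> reg st b.+2 = q -> reg st b.+3 = acc ->
  wp 0 (scan_nbr b mem_prog arg res) (fun st' => reg st' b.+3 = scan p c q acc) (6 + a) st.
Proof.
move=> inv qn bp bc bq bacc; have rNE := Inv_n inv.
have pn := ltn_ord p; pose y := rotate p q.
apply: thenP; apply: assignP.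
- by rewrite /compilable /= /regs; lia.
- by rewrite /= /fits_word /= bp bq; repeat split; lia.
have -> : eval inp st ((#b + #(b.+2) + $1) %% #rN) = y.
  by rewrite /= bp bq rNE -addnA addn1.
have [||||//|safe_edge edgeE] := @edge_safe (set_reg st b.+4 y) #(b.+1) #(b.+4) c y.
- by reg_simpl.
- by rewrite [eval _ _ _]reg_set_neq //; lia.
- exact: reg_set_eq.
- by [].
apply: ifteP => //.
- by rewrite /compilable /= /regs; lia.
- rewrite edgeE => ecy; apply: thenP; apply: assignP => //.
    by rewrite /compilable /= /regs; lia.
  rewrite [eval _ _ _]reg_set_eq; set st1 := set_reg _ _ _; apply: thenP.
  have inv1 : Inv st1 by apply: Inv_agree inv => // r br; rewrite /st1; reg_simpl.
  have arg1 : reg st1 arg = y by rewrite /st1 reg_set_eq.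
  apply: callP (mem_prog_spec inv1 arg1) (leqnn 0) (leq_addl 2 a) _ => st2 un resE.
  have un_r r : b <= r -> reg st2 r = reg st1 r by move=> br; rewrite un.1 ?mem_regs.
  apply: ifteP => //; rewrite /= ?resE; first by rewrite /compilable /= /regs; lia.
  + move=> yZ; apply: assignP => //; first by rewrite /compilable /= /regs; lia.
    rewrite [eval _ _ _]un_r; last lia; rewrite /st1; reg_simpl.
    by rewrite /scan -/y; case: (e c y) (y \in Z) ecy yZ => [] [].
  + move=> yZ; apply: nopP; rewrite un_r; last lia; rewrite /st1; reg_simpl.
    by rewrite bacc /scan -/y; case: (y \in Z) yZ; rewrite ?andbF.
- by rewrite edgeE => ecy; apply: nopP; reg_simpl; rewrite bacc /scan -/y; case: (e c y) ecy.
Qed.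

Lemma step_walk_spec st (p c : 'I_n) : Inv st -> reg st b = p -> reg st b.+1 = c ->
  wp 0 (step_walk b mem_prog arg res)
    (fun st' => reg st' b = c /\ reg st' b.+1 = next_nbr e Z p c) (13 + a) st.
Proof.
move=> inv bp bc.
apply: thenP; apply: assignP => //; first by rewrite /compilable /= /regs; lia.
rewrite /= -/(set_reg st b.+3 _) bc; set st0 := set_reg _ _ _; apply: thenP.
have inv0 : Inv st0 by apply: Inv_agree inv => // r br; rewrite /st0; reg_simpl.
have [bp0 bc0 acc0] : [/\ reg st0 b = p, reg st0 b.+1 = c & reg st0 b.+3 = c].
  by rewrite /st0; split; reg_simpl.
move: st0 inv0 bp0 bc0 acc0 => st0 inv0 bp0 bc0 acc0.
have un_loop st' : unchanged (For b.+2 #rN (scan_nbr b mem_prog arg res)) st0 st' ->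
    forall r, (r \in [:: b; b.+1]) || (b.+4 < r) -> reg st' r = reg st0 r.
  move=> un r; rewrite !inE => rP.
  by rewrite un.1 // /= !(in_nil, inE, mem_cat) !negb_or mem_regs; lia.
apply: (forP (f := scan p c) (R := fun _ (acc : 'I_n) st' => reg st' b.+3 = acc)
  (N := n) (y0 := c)) => //.
- apply/and3P; split=> //; first by rewrite /regs; lia.
  by rewrite /= !(in_nil, inE, mem_cat) !negb_or mem_regs; lia.
- exact: Inv_n.
- lia.
- by reg_simpl.
- move=> q acc st' qn un accE; have un_r := un_loop _ un.
  apply: step_walk_scan; rewrite ?reg_set_eq //; reg_simpl; rewrite ?accE ?un_r ?inE ?eqxx ?orbT //.
  apply: Inv_agree inv0 => [r br|q'].
    by reg_simpl; rewrite un_r ?br ?orbT.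
  by rewrite /= un.2 //= mem_arrs.
- move=> st' un resE; have un_r := un_loop _ un.
  apply: thenP; apply: assignP => //; first by rewrite /compilable /= /regs; lia.
  apply: assignP; rewrite /compilable //=; first by rewrite /regs; lia.
  split; first by rewrite ltn_eqF // eqxx un_r ?inE ?eqxx ?orbT.
  by rewrite eqxx gtn_eqF ?resE // ltnW.
Qed.

End StepWalk.

Lemma step_old_spec i wl sl st (p c : 'I_n) : instance i wl sl st -> size wl <= cap ->
  reg st rOldPrev = p -> reg st rOldCur = c ->
  wp 0 step_old (fun st' => reg st' rOldPrev = c /\
    reg st' rOldCur = next_nbr e (old_graph i wl) p c) 24 st.
Proof.
move=> inst wl_cap; apply: (step_walk_spec (a := 11) (Inv := instance i wl sl)) => //.
- by move=> r; rewrite /= !inE; lia.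
- move=> st1 st2 regE arrE [? ? ? ? ?]; split; rewrite ?regE ?arrE //.
- by move=> st1 [].
- by move=> st1 x inst1 xE; apply: mem_old_spec inst1 wl_cap xE.
Qed.

Lemma tour_expr_safe st : reg st rN = n ->
  safe cap G inp st tour /\ eval inp st tour = tour_len n'.
Proof.
move=> rNE; rewrite /= /fits_word /= rNE /tour_len addn1.
by do !split; lia.
Qed.

Lemma tour_lt_G : n * tour_len n' < G.
Proof. by apply: leq_trans G_ge; rewrite /tour_len; nia. Qed.

Lemma position_spec i wl sl st t : instance i wl sl st -> size wl <= cap -> reg st rTime = t ->
  t < n * tour_len n' ->
  wp 0 position (fun st' => reg st' rPos = oapp val n (tour_pos e (old_graph i wl) t)) 33 st.
Proof.
move=> inst wl_cap tE t_lt; set F := old_graph i wl; have rNE := inst_n inst.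
set r : 'I_n := inord (t %/ tour_len n').
have rE : t %/ tour_len n' = r by rewrite inordK // ltn_divLR.
have root_expr st' : reg st' rN = n -> reg st' rTime = t ->
    safe cap G inp st' (#rTime %/ tour) /\ eval inp st' (#rTime %/ tour) = r.
  move=> nE' tE'; have [safe_tour tourE] := tour_expr_safe nE'.
  by split=> //; rewrite -rE -tE' -tourE.
have [safe_root evalE] := root_expr st rNE tE.
apply: thenP; apply: assignP; rewrite // evalE; apply: thenP; apply: assignP => //; rewrite /=.
set st0 := set_reg _ _ _; apply: thenP.
have [safe_tour tourE] := tour_expr_safe (rNE : reg st0 rN = n).
apply: (forP (f := fun _ => walk_move e F) (y0 := (r, r)) (N := t %% tour_len n')
  (R := fun _ pc st' => reg st' rOldPrev = pc.1 /\ reg st' rOldCur = pc.2)) => //.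
- by rewrite -tourE -tE.
- apply: leq_trans (ltnW (ltn_pmod _ (ltn0Sn _))) (leq_trans _ (ltnW tour_lt_G)).
  exact: leq_pmull.
- move=> j [p c] st1 jt un [pE cE].
  apply: callP (step_old_spec (i := i) (sl := sl) (p := p) (c := c) _ wl_cap _ _) _ _ _ => //.
  by instances.
move=> st1 un; rewrite foldr_iter size_iota => -[_ curE].
have [||safe_root1 evalE1] := root_expr st1; try by state_simpl.
apply: thenP; apply: assignP; rewrite // evalE1; apply: thenP.
apply: callP (mem_old_spec (i := i) (wl := wl) (sl := sl) (x := r) _ wl_cap _) _ _ _ => //.
  by instances.
move=> st2 un2 resE; apply: ifteP; rewrite //= resE => rF; apply: assignP => //; state_simpl.
  by rewrite curE /tour_pos -/r; case: (r \in F) rF.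
by rewrite rNE /tour_pos -/r; case: (r \in F) rF.
Qed.

Lemma mem_visited_spec i wl sl lim st (x : 'I_n) : instance i wl sl st -> size wl <= cap ->
  reg st rLim = lim -> lim <= n * tour_len n' -> reg st rVisArg = x ->
  wp 0 mem_visited_prog
    (fun st' => reg st' rVisRes = (x \in visited e (old_graph i wl) lim)) 43 st.
Proof.
move=> inst wl_cap limE lim_le xE.
apply: (anyP (R := fun _ _ => True) (N := lim)
  (P := fun t => tour_pos e (old_graph i wl) t == Some x)) => //.
- exact: leq_trans lim_le (ltnW tour_lt_G).
- move=> t st1 t_lt un _; apply: thenP; apply: assignP => //; rewrite /=.
  apply: callP (position_spec (i := i) (wl := wl) (sl := sl) (t := t) _ wl_cap _ _) _ _ _ => //.
  + by instances.
  + exact: leq_trans t_lt lim_le.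
  + move=> st2 un2 posE; split=> //; state_simpl.
    by rewrite posE xE oapp_val_eq eqb0 negbK.
- by move=> st1 _ _ ->; rewrite inE.
Qed.

Record live_instance i wl sl lim bnd st : Prop := LiveInstance {
  live_base : instance i wl sl st;
  live_lim : reg st rLim = lim;
  live_bnd : reg st rBnd = bnd }.

Ltac live_instances := match goal with inst : live_instance _ _ _ _ _ _ |- _ =>
  by case: inst => -[? ? ? ? ?] ? ?; split; [split|..]; state_simpl end.

Section Live.
Variables (i : nat) (wl sl : seq nat) (lim bnd : nat).
Hypotheses (wl_cap : size wl <= cap) (sl_cap : size sl <= cap).
Hypothesis lim_le : lim <= n * tour_len n'.
Local Notation Z := (live (below bnd) (vset sl) (visited e (old_graph i wl) lim)).
Local Notation live_inst := (live_instance i wl sl lim bnd).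

Lemma mem_live_spec st (x : 'I_n) : live_inst st -> reg st rLiveArg = x ->
  wp 0 mem_live (fun st' => reg st' rLiveRes = (x \in Z)) 48 st.
Proof.
move=> inst xE; have [[rNE rKE rIE rootsE deletedE] limE bndE] := inst.
apply: thenP; apply: assignP => //; rewrite /= xE; apply: thenP.
apply: callP (@mem_array_spec aDeleted sl _ _ _ _ _ _) _ _ _ => //=.
move=> st1 un1 foundE; apply: thenP; apply: assignP; rewrite //=; state_simpl.
rewrite foundE bndE xE and_notE; apply: thenP; apply: assignP => //; state_simpl.
rewrite xE; apply: thenP.
apply: callP (@mem_visited_spec i wl sl lim _ x _ wl_cap _ lim_le _) _ _ _ => //.
- by split; state_simpl.
- by state_simpl.
move=> st2 un2 visE; apply: assignP => //; state_simpl.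
rewrite visE and_notE !in_setD in_vset in_below andbC; congr nat_of_bool.
by congr andb; rewrite andbC.
Qed.

Lemma step_live_spec st (p c : 'I_n) :
  live_inst st -> reg st rLivePrev = p -> reg st rLiveCur = c ->
  wp 0 step_live (fun st' => reg st' rLivePrev = c /\ reg st' rLiveCur = next_nbr e Z p c) 61 st.
Proof.
apply: (step_walk_spec (a := 48) (Inv := live_inst)) => //.
- by move=> r; rewrite /= !inE; lia.
- by move=> st1 st2 regE arrE [[? ? ? ? ?] ? ?]; split; [split|..]; rewrite ?regE ?arrE.
- by move=> st1 [[]].
- exact: mem_live_spec.
Qed.

Definition link_pred (rooted : bool) (v u x : 'I_n) : bool :=
  if rooted then x \in vset wl else (x != u) && e v x.

Lemma link_test_spec (rooted : bool) st (v u c : 'I_n) :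
  live_inst st -> reg st rRootTest = rooted ->
  reg st rCenter = v -> reg st rNbr = u -> reg st rLiveCur = c ->
  wp 0 link_test (fun st' => reg st' rTest = link_pred rooted v u c) 12 st.
Proof.
move=> inst rootedE vE uE cE; have [[rNE rKE _ rootsE _] _ _] := inst.
apply: ifteP; rewrite //= rootedE.
  case: rooted {rootedE} => // _; apply: thenP; apply: assignP => //; rewrite /= cE; apply: thenP.
  apply: callP (@mem_array_spec aRoots wl _ _ _ _ _ _) _ _ _ => //=.
  by move=> st1 un1 foundE; apply: assignP; rewrite //= foundE in_vset.
case: rooted {rootedE} => // _.
have [||||safe_edge edgeE] // := @edge_safe st #rCenter #rLiveCur v c rNE.
apply: assignP => //.
have -> : eval inp st ((~~ (#rLiveCur == #rNbr)) && edge #rCenter #rLiveCur) =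
  (1 - (c == u :> nat)) - (1 - e v c) by rewrite -edgeE /= cE uE.
by rewrite /= (inj_eq val_inj); case: (c == u); case: (e v c).
Qed.

Lemma walk_hits_spec (rooted : bool) st (v u : 'I_n) : live_inst st ->
  reg st rRootTest = rooted -> reg st rCenter = v -> reg st rNbr = u ->
  wp 0 walk_hits_prog
    (fun st' => reg st' rHit = walk_hits e Z u (link_pred rooted v u)) 76 st.
Proof.
move=> inst rootedE vE uE; have rNE := inst_n (live_base inst).
apply: thenP; apply: assignP => //; rewrite /= uE.
apply: thenP; apply: assignP => //; rewrite /= uE.
set st0 := set_reg _ _ _; set T := tour_len n'.
have [safe_tour tourE] := tour_expr_safe (rNE : reg (set_reg st0 rHit 0) rN = n).
apply: (anyP (N := T) (P := fun j => link_pred rooted v u (walk e Z u (T - j.+1)))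
  (R := fun j st' => let pc := iter (T - j) (walk_move e Z) (u, u) in
     reg st' rLivePrev = pc.1 /\ reg st' rLiveCur = pc.2)) => //.
- exact: leq_trans (leq_pmull _ _) (ltnW tour_lt_G).
- by rewrite subnn.
- move=> j st1 jT un [pE cE].
  have step : T - j = (T - j.+1).+1 by rewrite subnSK.
  set pc := iter _ _ _ in pE cE.
  apply: thenP; apply: callP (@link_test_spec rooted _ v u pc.2 _ _ _ _ _) _ _ _ => //.
  + by live_instances.
  + by state_simpl.
  + by state_simpl.
  + by state_simpl.
  move=> st2 un2 testE; apply: callP (step_live_spec (p := pc.1) (c := pc.2) _ _ _) _ _ _ => //.
  + by live_instances.
  + by state_simpl.
  + by state_simpl.
  move=> st3 un3 [pE3 cE3]; rewrite step; split=> //; state_simpl.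
  by rewrite testE eqb0 negbK.
- move=> st1 un _ ->; congr nat_of_bool.
  exact: (has_iota_rev (fun j => link_pred rooted v u (walk e Z u j))).
Qed.

Lemma count_nbr_spec (rooted : bool) st (v u : 'I_n) c : live_inst st ->
  reg st rRootTest = rooted -> reg st rCenter = v -> reg st rNbr = u ->
  reg st rLinked = c -> c < n ->
  wp 0 count_nbr (fun st' => reg st' rLinked =
    [&& e v u, u \in Z & walk_hits e Z u (link_pred rooted v u)] + c) 82 st.
Proof.
move=> inst rootedE vE uE cE cn; have rNE := inst_n (live_base inst).
have [||||safe_edge edgeE] // := @edge_safe st #rCenter #rNbr v u rNE.
apply: ifteP; rewrite // edgeE => euv; last by apply: nopP; case: (e v u) euv.
apply: thenP; apply: assignP => //; rewrite /= uE; apply: thenP.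
apply: callP (mem_live_spec (x := u) _ _) _ _ _ => //; first by live_instances.
move=> st1 un1 liveE; apply: ifteP; rewrite //= liveE => uZ; last first.
  by apply: nopP; state_simpl; case: (u \in Z) uZ; rewrite // andbF.
apply: thenP; apply: callP (@walk_hits_spec rooted _ v u _ _ _ _) _ _ _ => //.
- by live_instances.
- by state_simpl.
- by state_simpl.
- by state_simpl.
move=> st2 un2 hitE; apply: assignP; rewrite //=; state_simpl; rewrite hitE cE.
  by split=> //; case: walk_hits; lia.
by case: (e v u) (u \in Z) euv uZ => [] [].
Qed.

Lemma count_linked_spec (rooted : bool) st (v : 'I_n) : live_inst st ->
  reg st rRootTest = rooted -> reg st rCenter = v ->
  wp 0 count_linked (fun st' => reg st' rLinked = linked e Z v (link_pred rooted v)) 90 st.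
Proof.
move=> inst rootedE vE; have rNE := inst_n (live_base inst).
pose hit q := [&& e v (inord q), inord q \in Z &
  walk_hits e Z (inord q) (link_pred rooted v (inord q))].
apply: thenP; apply: assignP => //.
apply: (forP (N := n) (y0 := 0) (f := fun q c => hit q + c)
  (R := fun q c st' => reg st' rLinked = c /\ c + q <= n)) => //; first by lia.
- move=> q c st1 qn un [cE c_le]; pose u : 'I_n := inord q.
  have uE : q = u by rewrite inordK.
  apply: callP (@count_nbr_spec rooted _ v u c _ _ _ _ _ _) _ _ _ => //.
  + by live_instances.
  + by state_simpl.
  + by state_simpl.
  + by rewrite (leq_trans _ c_le) // addnS ltnS leq_addr.
  + by move=> st2 un2 ->; rewrite /hit -/u; split=> //; case: (_ && _) => /=; lia.
- by move=> st1 un [-> _]; rewrite /linked; elim: (iota 0 n) => //= q qs ->.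
Qed.

End Live.

Definition deletions sl st : Prop :=
  [/\ encodes cap (arr st aDeleted) sl, reg st rCnt = size sl & size sl <= k].

Lemma push_spec x sl v st : compilable 0 x -> safe cap G inp st x -> eval inp st x = v ->
  reg st rK = k -> deletions sl st ->
  wp 0 (push x) (deletions (if size sl < k then rcons sl v else sl)) 3 st.
Proof.
move=> cx sx xE rKE [slE cntE sl_k].
apply: ifteP; rewrite //= cntE rKE; case: ltnP => // sl_lt _; last by apply: nopP.
apply: thenP; apply: storeP; rewrite //= ?cx //; first by lia.
rewrite xE cntE; apply: assignP; rewrite //=; first by split=> //; lia.
by split; rewrite ?size_rcons //= ?cntE ?addn1 //; apply: encodes_upd_size.
Qed.

Lemma append_bits_spec ys y st : encodes cap (arr st aBits) ys -> reg st rBits = size ys ->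
  (size ys).+1 < cap -> reg st rItem = y ->
  wp 0 append_bits (fun st' => let ys' := ys ++ [:: y.-1 %% 2; y.-1 %/ 2] in
    encodes cap (arr st' aBits) ys' /\ reg st' rBits = size ys') 3 st.
Proof.
move=> ysE bitsE ys_cap yE.
apply: thenP; apply: storeP; rewrite //= bitsE; first by lia.
apply: thenP; apply: storeP; rewrite //= bitsE; [by split=> //; lia | by lia |].
apply: assignP; rewrite //= bitsE; first by split=> //; lia.
rewrite yE subn1 size_cat; split=> //.
rewrite addn1 -(size_rcons ys (y.-1 %% 2)).
have -> : ys ++ [:: y.-1 %% 2; y.-1 %/ 2] = rcons (rcons ys (y.-1 %% 2)) (y.-1 %/ 2).
  by rewrite -!cats1 -catA.
by do 2 apply: encodes_upd_size.
Qed.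

Lemma read_digits_spec x wl st : reg st rK = k -> encodes cap (arr st aRoots) wl ->
  (forall j, j <= k -> arr st aDigits j = x j) ->
  encodes cap (arr st aDeleted) [::] -> encodes cap (arr st aBits) [::] ->
  wp 0 read_digits (fun st' =>
    let: (sl, ys) := foldr (digit_step wl k x) ([::], [::]) (iota 0 k.+1) in
    deletions sl st' /\ encodes cap (arr st' aBits) ys) 14 st.
Proof.
move=> rKE rootsE digitsE deletedE bitsE.
apply: thenP; apply: assignP => //; apply: thenP; apply: assignP => //.
apply: (forP (N := k.+1) (y0 := ([::], [::])) (f := digit_step wl k x)
  (R := fun j s st' => [/\ deletions s.1 st', encodes cap (arr st' aBits) s.2,
     reg st' rBits = size s.2 & size s.2 <= (k.+1 - j).*2])) => //.
- by rewrite /= /fits_word /= rKE; split=> //; lia.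
- by rewrite /= rKE addn1.
- lia.
- move=> j [sl ys] st1 jk un [/= delE ysE cntE ys_le].
  have jc : j < cap by lia.
  apply: thenP; apply: assignP; rewrite //=.
  state_simpl; rewrite digitsE // /digit_step; apply: ifteP; rewrite //= => xj.
    apply: callP (append_bits_spec (ys := ys) (y := x j) _ _ _ _) _ _ _ => //=; first by lia.
    move=> st2 un2 [ysE2 cntE2]; rewrite (negPf xj) /=; split=> //.
      by case: delE => ? ? ?; split; state_simpl.
    by rewrite size_cat /=; lia.
  apply: callP (push_spec (sl := sl) (v := nth 0 wl j) _ _ _ _ _) _ _ _ => //=.
  + by state_simpl; rewrite rootsE.
  + by state_simpl.
  move=> st2 un2 delE2; rewrite xj /=; split=> //; state_simpl => //.
  lia.
- by move=> st1 un; case: foldr => sl ys [].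
Qed.

Section Guessing.
Variables (i : nat) (wl ys : seq nat).
Hypothesis wl_cap : size wl <= cap.
Local Notation F := (old_graph i wl).
Local Notation guess := (guess_step e i wl k (nth 0 ys)).

Record guess_state (s : seq nat * nat) st : Prop := GuessState {
  guess_inst : instance i wl s.1 st;
  guess_bits : encodes cap (arr st aBits) ys;
  guess_bnd : reg st rBnd = i;
  guess_cnt : reg st rCnt = size s.1;
  guess_size : size s.1 <= k;
  guess_used : reg st rUsed = s.2;
  guess_used_le : s.2 <= cap }.

Lemma guess_vertex_spec sl used st t (v : 'I_n) : guess_state (sl, used) st ->
  reg st rIdx = t -> reg st rItem = v -> t < n * tour_len n' ->
  wp 0 guess_vertex (guess_state
    (if (1 < linked e (live_at e i F sl t.+1) v (fun _ x => x \in vset wl)) && (used < cap)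
     then (if (nth 0 ys used != 0) && (size sl < k) then rcons sl v.+1 else sl, used.+1)
     else (sl, used))) 94 st.
Proof.
move=> gs tE vE t_lt; have tour_G := tour_lt_G; have v_lt := ltn_ord v.
have [[rNE rKE rIE rootsE deletedE] bitsE bndE cntE sl_k usedE used_le] := gs.
have sl_cap : size sl <= cap by move: sl_k => /=; lia.
apply: thenP; apply: assignP; rewrite //= tE addn1; first by split=> //; lia.
apply: thenP; apply: assignP => //; rewrite /= vE; apply: thenP; apply: assignP => //; rewrite /=.
set st0 := set_reg _ _ _; apply: thenP.
have live0 : live_instance i wl sl t.+1 i st0 by split; [split|..].
apply: callP (count_linked_spec wl_cap sl_cap t_lt (rooted := true) (v := v) live0 _ _) _ _ _ => //.
move=> st1 un1; rewrite /link_pred -/(live_at e i F sl t.+1).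
move: (linked _ _ _ _) => links linksE.
have [|safe_slots slotsE] := @slots_safe st1; first by state_simpl.
have condE : eval inp st1 (($1 < #rLinked) && (#rUsed < slots))%prog = (1 < links) && (used < cap).
  rewrite [LHS]/= -[_ * 2 + 2]/(eval inp st1 slots) slotsE linksE; state_simpl.
  by rewrite usedE; case: (1 < links); case: (used < _).
apply: ifteP; rewrite // condE => cond; last first.
  rewrite (_ : _ && _ = false); last by case: (_ && _) cond.
  by apply: nopP; split; [split|..]; state_simpl.
have {}cond : (1 < links) && (used < cap) by case: (_ && _) cond.
rewrite cond; have /andP[_ used_lt] := cond.
apply: thenP; apply: assignP; rewrite //=; state_simpl; rewrite vE addn1; first by split=> //; lia.
set sl' := if _ && _ then _ else sl; set st2 := set_reg _ _ _.
have bitE : eval inp st2 (Arr aBits #rUsed) = nth 0 ys used.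
  by rewrite /=; state_simpl; rewrite usedE bitsE.
have pushed : wp 0 (Ifte (Arr aBits #rUsed) (push #rItem) Nop) (deletions sl') 4 st2.
  have del2 : deletions sl st2 by split; state_simpl.
  apply: ifteP => //; rewrite ?bitE.
  - by split=> //; state_simpl; rewrite usedE.
  - by move=> bit; rewrite /sl' bit; apply: push_spec => //; state_simpl.
  - by move=> bit; apply: nopP; rewrite /sl' bit.
apply: thenP; apply: callP pushed _ _ _ => // st3 un3 [slE' cntE' sl'_k].
apply: assignP; rewrite //=; state_simpl; rewrite usedE; first by split=> //; lia.
by rewrite addn1; split; [split|..]; state_simpl.
Qed.

Lemma visit_position_spec s st t : guess_state s st -> reg st rIdx = t ->
  t < n * tour_len n' -> wp 0 visit_position (guess_state (guess t s)) 102 st.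
Proof.
move=> gs tE t_lt; case: s gs => sl used gs; rewrite /guess_step.
have [[rNE rKE rIE rootsE deletedE] bitsE bndE cntE sl_k usedE used_le] := gs.
apply: thenP; apply: assignP => //; rewrite /= tE; apply: thenP.
apply: callP (position_spec (i := i) (wl := wl) (sl := sl) (t := t) _ wl_cap _ _) _ _ _ => //.
move=> st1 un1 posE; apply: thenP; apply: assignP => //; rewrite /= posE.
apply: ifteP; rewrite //=; state_simpl; rewrite rNE => pos_lt; last first.
  case: (tour_pos _ _ _) pos_lt => [v|] /=; first by rewrite ltn_ord.
  by move=> _; apply: nopP; split; [split|..]; state_simpl.
case: (tour_pos _ _ _) posE pos_lt => [v|] /= posE; last by rewrite ltnn.
move=> _; apply: thenP; apply: assignP => //; apply: thenP; apply: assignP => //; rewrite /=.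
apply: thenP; state_simpl; rewrite tE.
apply: callP (@mem_visited_spec i wl sl t _ v _ wl_cap _ (ltnW t_lt) _) _ _ _ => //.
  by split; state_simpl.
move=> st2 un2 visE; apply: ifteP; rewrite //= visE => vis.
  by rewrite (_ : v \in _); [apply: nopP; split; [split|..]; state_simpl | case: (v \in _) vis].
rewrite (_ : v \in _ = false); last by case: (v \in _) vis.
apply: callP (@guess_vertex_spec sl used _ t v _ _ _ t_lt) _ _ _ => //; try by state_simpl.
by split; [split|..]; state_simpl.
Qed.

Lemma guess_all_spec sl st : instance i wl sl st -> encodes cap (arr st aBits) ys ->
  reg st rCnt = size sl -> size sl <= k ->
  wp 0 guess_all (fun st' => encodes cap (arr st' aDeleted)
    (foldr guess (sl, 0) (iota 0 (n * tour_len n'))).1) 110 st.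
Proof.
move=> inst bitsE cntE sl_k; have [rNE rKE rIE rootsE deletedE] := inst.
apply: thenP; apply: assignP => //; apply: thenP; apply: assignP => //; rewrite /= rIE.
set st0 := set_reg _ _ _.
have rNE0 : reg st0 rN = n := rNE; have [safe_tour tourE] := tour_expr_safe rNE0.
apply: (forP (N := n * tour_len n') (y0 := (sl, 0)) (f := guess) (R := fun _ => guess_state)) => //.
- split=> //; rewrite /fits_word [binop_val _ _ _]/(reg st0 rN * eval inp st0 tour) tourE.
  by rewrite rNE0; apply: tour_lt_G.
- by rewrite [LHS]/(reg st0 rN * eval inp st0 tour) tourE rNE0.
- exact: ltnW tour_lt_G.
- move=> j s st1 jN un gs; apply: callP (visit_position_spec (s := s) (t := j) _ _ jN) _ _ _ => //.
  by case: gs => -[? ? ? ? ?] ? ? ? ? ? ?; split; [split|..].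
- by move=> st1 _ [[_ _ _ _ ?]].
Qed.

End Guessing.

Lemma build_candidate_spec i wl x st : size wl <= cap -> reg st rN = n -> reg st rK = k ->
  reg st rI = i -> encodes cap (arr st aRoots) wl ->
  (forall j, j <= k -> arr st aDigits j = x j) ->
  wp 0 build_candidate
    (fun st' => encodes cap (arr st' aDeleted) (candidate e i wl k x)) 114 st.
Proof.
move=> wl_cap rNE rKE rIE rootsE digitsE.
apply: thenP; have [safe_slots slotsE] := slots_safe rKE.
apply: (fillP (f := fun=> 0) (N := cap)) => //; first exact: cap_le_G.
move=> st1 un1 clear1; apply: thenP.
have [|safe_slots1 slotsE1] := @slots_safe st1; first by state_simpl.
apply: (fillP (f := fun=> 0) (N := cap)) => //; first exact: cap_le_G.
move=> st2 un2 clear2; apply: thenP.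
apply: callP (@read_digits_spec x wl st2 _ _ _ _ _) _ _ _ => //.
- by state_simpl.
- by state_simpl.
- by move=> j jk; state_simpl; apply: digitsE.
- by move=> j jc; state_simpl; rewrite clear1 // nth_nil.
- by move=> j jc; state_simpl; rewrite clear2 // nth_nil.
move=> st3 un3; rewrite /candidate; case: foldr => sl ys [[slE cntE sl_k] ysE].
apply: callP (guess_all_spec (i := i) (ys := ys) wl_cap (sl := sl) _ _ _ _) _ _ _ => //.
by split; state_simpl.
Qed.

Lemma check_vertex_spec i wl sl st j : instance i wl sl st -> size wl <= cap -> size sl <= cap ->
  reg st rLim = 0 -> reg st rRootTest = 0 -> reg st rIdx = j -> j < n ->
  wp 0 check_vertex_prog
    (fun st' => (reg st' rLinked != 0) = ~~ check_vertex e sl (inord j)) 96 st.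
Proof.
move=> inst wl_cap sl_cap limE modeE jE j_lt; pose v : 'I_n := inord j.
have vE : j = v by rewrite inordK.
have [rNE rKE rIE rootsE deletedE] := inst.
apply: thenP; apply: assignP => //; apply: thenP; apply: assignP => //; rewrite /= jE.
apply: thenP; apply: callP (@mem_array_spec aDeleted sl _ _ _ _ _ _) _ _ _ => //=.
move=> st1 un1 foundE; rewrite vE -in_vset in foundE.
rewrite /check_vertex -/v; apply: ifteP; rewrite //= foundE => vsl.
  by apply: nopP; state_simpl; case: (v \in vset sl) vsl.
have {}vsl : v \in vset sl = false by case: (v \in _) vsl.
apply: thenP; apply: assignP => //; apply: thenP; apply: assignP => //; rewrite /=.
state_simpl; rewrite jE vE.
apply: callP (@count_linked_spec _ _ _ _ _ wl_cap sl_cap (leq0n _) false _ v _ _ _) _ _ _ => //.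
- by split; [split|..]; state_simpl.
- by state_simpl.
move=> st2 un2 ->; rewrite vsl /= live_at0 visited0 /live setD0; exact: erefl.
Qed.

Lemma check_spec i wl sl st : instance i wl sl st -> size wl <= cap -> size sl <= cap -> i <= n ->
  wp 0 check_prog (fun st' => reg st' rBad = ~~ check e i sl) 109 st.
Proof.
move=> inst wl_cap sl_cap lin; have rIE := inst_i inst.
apply: thenP; apply: assignP => //; apply: thenP; apply: assignP => //; rewrite /=.
apply: (anyP (N := i) (R := fun _ _ => True) (P := fun j => ~~ check_vertex e sl (inord j))) => //.
- lia.
- move=> j st1 ji un _.
  apply: callP (@check_vertex_spec i wl sl _ j _ wl_cap sl_cap _ _ _ _) _ _ _ => //;
    try by state_simpl.
  + by instances.
  + exact: leq_trans ji lin.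
- by move=> st1 un _ ->; rewrite has_predC.
Qed.

Definition digit V j := V %/ 5 ^ (k - j) %% 5.

Lemma digit_lt V j : digit V j < 5. Proof. by rewrite ltn_mod. Qed.

Lemma next_digit_spec V st j : j <= k -> reg st rDigit = j ->
  reg st rCarry = (5 ^ (k - j) %| V.+1) -> arr st aDigits j = digit V j ->
  wp 0 next_digit (fun st' => reg st' rCarry = (5 ^ (k.+1 - j) %| V.+1) /\
    arr st' aDigits =1 upd (arr st aDigits) j (digit V.+1 j)) 5 st.
Proof.
move=> jk jE carryE digitE; have jc : j < cap by lia.
have pow_gt0 : 0 < 5 ^ (k - j) by rewrite expn_gt0.
have powS : 5 ^ (k.+1 - j) = 5 * 5 ^ (k - j) by rewrite subSn // expnS.
apply: ifteP; rewrite //= carryE => carry; last first.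
  have {}carry : (5 ^ (k - j) %| V.+1) = false by case: (_ %| _) carry.
  have [digitS carryS] := succ_digit_nocarry pow_gt0 carry.
  apply: nopP; rewrite carryE carry powS carryS; split=> // l.
  by rewrite /= /digit digitS; case: eqP => // ->.
have {}carry : 5 ^ (k - j) %| V.+1 by case: (_ %| _) carry.
have [digitS carryS] := succ_digit_carry pow_gt0 carry.
rewrite -/(digit V j) -/(digit V.+1 j) in digitS; rewrite -/(digit V j) -powS in carryS.
apply: thenP; apply: assignP; rewrite //= jE digitE.
  by split=> //; have := digit_lt V j; lia.
apply: ifteP; rewrite //= => five.
  apply: storeP; rewrite //= jE //.
  have {}five : digit V j + 1 == 5 by case: (_ + _ == _) five.
  by rewrite carryE carry carryS digitS five.
have {}five : (digit V j + 1 == 5) = false by case: (_ + _ == _) five.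
apply: thenP; apply: storeP; rewrite //= jE //; apply: assignP => //=.
by rewrite carryS digitS five.
Qed.

Lemma next_digits_spec V st : reg st rK = k -> (forall j, j <= k -> arr st aDigits j = digit V j) ->
  wp 0 next_digits (fun st' => reg st' rCarry = (5 ^ k.+1 %| V.+1) /\
    forall j, j <= k -> arr st' aDigits j = digit V.+1 j) 12 st.
Proof.
move=> rKE digitE.
apply: thenP; apply: assignP => //.
apply: (forP (N := k.+1) (y0 := tt) (f := fun _ u => u)
  (R := fun j _ st' => reg st' rCarry = (5 ^ (k.+1 - j) %| V.+1) /\
     forall l, l <= k -> arr st' aDigits l = if j <= l then digit V.+1 l else digit V l)) => //.
- by safety.
- by rewrite /= rKE addn1.
- lia.
- split=> [|l lk]; first by rewrite /= subnn dvd1n.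
  by rewrite /= digitE // ltnNge lk.
- move=> j _ st1 jk un; rewrite subSS => -[carryE digitsE].
  apply: callP (@next_digit_spec V _ j jk _ _ _) _ _ _ => //=.
  + by rewrite digitsE // ltnn.
  + move=> st2 un2 [carryE2 digitsE2]; split=> // l lk.
    rewrite digitsE2 /= digitsE //; case: eqP => [->|/eqP nlj]; first by rewrite leqnn.
    by rewrite (leq_eqVlt j) eq_sym (negPf nlj).
Qed.

Definition solved i wl st : Prop :=
  if reg st rSolved != 0 then
    exists sl, [/\ encodes cap (arr st aDeleted) sl, size sl <= k & check e i sl]
  else forall V, V < 5 ^ k.+1 -> ~~ check e i (candidate e i wl k (digit V)).

Section Search.
Variables (i : nat) (wl : seq nat).
Hypotheses (lin : i <= n) (wl_cap : size wl <= cap).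

(* [q] bounds the number of strings of digits that have not been tried. *)
Definition searching (q : nat) st : Prop :=
  [/\ reg st rN = n, reg st rK = k & reg st rI = i] /\ encodes cap (arr st aRoots) wl /\
  (reg st rSearching = 0 /\ solved i wl st \/
   exists V, [/\ [/\ reg st rSearching = 1, reg st rSolved = 0 & V + q = 5 ^ k.+1],
     V < 5 ^ k.+1, forall j, j <= k -> arr st aDigits j = digit V j &
     forall V', V' < V -> ~~ check e i (candidate e i wl k (digit V'))]).

Lemma try_digits_spec q st : searching q.+1 st -> reg st rSearching != 0 ->
  wp 0 try_digits (fun st' => exists2 q', q' <= q & searching q' st') 118 st.
Proof.
case=> -[rNE rKE rIE] [rootsE [[-> //]|[V [[_ unsolved Vq] V_lt digitsE none]]]] _.
apply: thenP; apply: callP (build_candidate_spec wl_cap rNE rKE rIE rootsE digitsE) _ _ _ => //.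
move=> st1 un1; set sl := candidate _ _ _ _ _ => slE.
have sl_k : size sl <= k := size_candidate _ _ _ _ _.
apply: thenP; apply: callP (@check_spec i wl sl st1 _ wl_cap _ lin) _ _ _ => //.
- by split; state_simpl.
- by lia.
move=> st2 un2 badE; apply: ifteP; rewrite //= badE => bad; last first.
  apply: thenP; apply: assignP => //; apply: assignP => //.
  exists 0 => //; split; first by split; state_simpl.
  split; first by move=> j jc; state_simpl; apply: rootsE.
  left; split=> //; exists sl; split=> //; last by case: (check _ _ _) bad.
  by state_simpl.
apply: thenP; apply: callP (@next_digits_spec V st2 _ _) _ _ _ => //.
- by state_simpl.
- by move=> j jk; state_simpl; apply: digitsE.
move=> st3 un3 [carryE digitsE3]; apply: assignP => //.
have none_S V' : V' < V.+1 -> ~~ check e i (candidate e i wl k (digit V')).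
  rewrite ltnS leq_eqVlt => /orP[/eqP ->|]; last exact: none.
  by case: (check _ _ _) bad.
exists q => //; split; first by split; state_simpl.
split; first by move=> j jc; state_simpl; apply: rootsE.
have [full|not_full] := boolP (5 ^ k.+1 %| V.+1).
  left; split; first by rewrite /= carryE full.
  rewrite /solved; state_simpl; rewrite unsolved /= => V' V'_lt; apply: none_S.
  by apply: leq_trans V'_lt _; apply: dvdn_leq.
right; exists V.+1; split=> //.
- by split; rewrite ?addSnnS //; state_simpl; rewrite ?carryE ?(negPf not_full).
- by rewrite ltn_neqAle V_lt andbT; apply: contraNneq not_full => ->.
Qed.

Lemma search_spec st : reg st rN = n -> reg st rK = k -> reg st rI = i ->
  encodes cap (arr st aRoots) wl -> wp k.+1 search (solved i wl) 122 st.
Proof.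
move=> rNE rKE rIE rootsE.
apply: thenP; apply: assignP => //; apply: thenP; apply: assignP => //; apply: thenP.
apply: (fillP (f := fun=> 0) (N := k.+1)) => //.
- by safety.
- by rewrite /= rKE addn1.
- lia.
- lia.
move=> st1 un1 clear1.
apply: (loopP (c' := 0) (b := 118) (I := searching) (j := 5 ^ k.+1)) => //.
- by move=> st2 [_ [_ [[]|[V [[_ _ VE] V_lt]]]]] //; move: V_lt; rewrite -VE addn0 ltnn.
- by move=> q st2 _; apply: try_digits_spec.
- by move=> q st2 _ [_ [_ [[_ sol]|[V [[r1 _ _] _ _ _]]]]] r0 //; rewrite r0 in r1.
- split; first by split; state_simpl.
  split; first by move=> j jc; state_simpl; apply: rootsE.
  right; exists 0; split; rewrite ?expn_gt0 //; first by split; state_simpl.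
  by move=> j jk; rewrite clear1 // /digit div0n mod0n.
- by rewrite mul1n ltn_pmul2l ?expn_gt0 // (pow_G_lt G_ge).
Qed.

End Search.

Section Compression.
Hypothesis e_sym : symmetric e.
Hypothesis e_irr : irreflexive e.

Definition acyclic_deletion : Prop := exists S : {set 'I_n}, #|S| <= k /\ acyclic e (~: S).

Definition padded_roots sl i : seq nat := sl ++ nseq (k - size sl) 0 ++ [:: i].

Lemma size_padded_roots sl i : size sl <= k -> size (padded_roots sl i) = k.+1.
Proof. by move=> sl_k; rewrite !size_cat size_nseq addnA subnKC // addn1. Qed.

Lemma no_candidate sl i : 0 < i -> i <= n -> size sl <= k ->
  acyclic e (below i.-1 :\: vset sl) ->
  (forall V, V < 5 ^ k.+1 -> ~~ check e i (candidate e i (padded_roots sl i) k (digit V))) ->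
  ~ acyclic_deletion.
Proof.
move=> i0 lin sl_k acs none [S [cS acS]].
have acF : acyclic e (old_graph i (padded_roots sl i)).
  apply: acyclic_sub acs; apply/subsetP => v; rewrite !in_setD !in_vset !in_below.
  rewrite !mem_cat negb_or => /andP[/andP[-> nv] vi] /=.
  move: nv; rewrite negb_or inE => /andP[_ nv]; lia.
have acS' : acyclic e (below i :\: S).
  by apply: acyclic_sub acS; apply/subsetP => v; rewrite in_setD in_setC => /andP[].
have roots_k : size (padded_roots sl i) <= k.+1 by rewrite size_padded_roots.
have [x x5 acx] := candidate_complete e_sym e_irr acF roots_k cS acS'.
have [V V_lt VE] := exists_base5 (x := fun l => x (k - l)) k.+1 (fun l => x5 _).
case/negP: (none V V_lt); apply/(checkP e_sym e_irr) => //.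
rewrite (@eq_candidate _ _ _ _ _ _ x) // => j jk.
by rewrite /digit VE ?ltnS ?leq_subr // subKn.
Qed.

Lemma encodes_padded_roots f sl i : size sl <= k -> encodes cap f sl ->
  encodes cap (upd f k i) (padded_roots sl i).
Proof.
move=> sl_k fE j jc; rewrite /upd /padded_roots catA nth_cat size_cat size_nseq subnKC //.
rewrite nth_cat nth_nseq if_same fE //; case: ltngtP => [jk|kj|->]; last by rewrite subnn.
  by case: ltnP => // jl; rewrite nth_default.
rewrite !nth_default //; last exact: leq_trans (ltnW kj).
by rewrite subn_gt0.
Qed.

Definition compressed b j st : Prop :=
  [/\ reg st rN = n, reg st rK = k, reg st rFailed = nat_of_bool b &
   if b then ~ acyclic_deletion else exists sl,
     [/\ encodes cap (arr st aRoots) sl, size sl <= k & acyclic e (below (n - j) :\: vset sl)]].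

Lemma add_vertex_spec j st : j < n -> reg st rRound = j -> compressed false j.+1 st ->
  wp k.+1 add_vertex (fun st' => exists b, compressed b j st') 130 st.
Proof.
move=> jn jE [rNE rKE failedE [sl [slE sl_k acs]]].
set i := n - j; have i0 : 0 < i by rewrite subn_gt0.
have lin : i <= n by apply: leq_subr.
rewrite (_ : n - j.+1 = i.-1) in acs; last by rewrite subnS.
apply: thenP; apply: assignP; rewrite //= rNE jE -/i.
apply: thenP; apply: storeP; rewrite //= rKE; first lia.
set st0 := set_arr _ _ _ _.
have rootsE : encodes cap (arr st0 aRoots) (padded_roots sl i) by apply: encodes_padded_roots.
have roots_cap : size (padded_roots sl i) <= cap by rewrite size_padded_roots //; lia.
apply: thenP; apply: callP (search_spec lin roots_cap (st := st0) rNE rKE erefl rootsE) _ _ _ => //.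
move=> st1 un1; rewrite /solved => sol; apply: ifteP; rewrite //= => found.
  move: sol; rewrite found => -[sl' [slE' sl'_k checked]].
  have [|safe_slots slotsE] := @slots_safe st1; first by state_simpl.
  apply: (fillP (f := arr st1 aDeleted) (N := cap)) => //; first exact: cap_le_G.
    by move=> l st2 lc un2; split; rewrite /= ?(un2.2 aDeleted isT).
  move=> st2 un2 copied; exists false; split; try by state_simpl.
  exists sl'; split=> //; last exact/(checkP e_sym e_irr).
  by move=> l lc; rewrite copied ?slE'.
move: sol; rewrite found /= => none; apply: assignP => //.
exists true; split; try by state_simpl.
exact: no_candidate i0 lin sl_k acs none.
Qed.

Lemma compression_spec st : reg st rN = n -> reg st rK = k -> encodes cap (arr st aRoots) [::] ->
  wp k.+1 compression (answers acyclic_deletion) 138 st.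
Proof.
move=> rNE rKE rootsE.
apply: thenP; apply: assignP => //; apply: thenP.
apply: (forP (N := n) (y0 := tt) (f := fun _ u => u)
  (R := fun j _ st' => exists b, compressed b j st')) => //; first lia.
- exists false; split=> //; exists [::]; split=> //.
  by rewrite subnn below0 set0D; apply: acyclic0.
- move=> j _ st1 jn un [[] [rNE1 rKE1 failedE P]]; apply: ifteP; rewrite //= failedE // => _.
    by apply: nopP; exists true.
  by apply: callP (@add_vertex_spec j _ jn _ _) _ _ _ => //.
- move=> st1 un [b [_ _ failedE P]]; apply: assignP => //; exists (~~ b).
    by rewrite /= failedE; case: (b).
  case: b P {failedE} => //= -[sl [slE sl_k acs]]; split=> // _.
  exists (vset sl); split; first exact: leq_trans (card_vset _ _) sl_k.
  apply: acyclic_sub acs; apply/subsetP => v.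
  by rewrite in_setC in_setD in_below subn0 ltn_ord andbT.
Qed.

End Compression.
End Programs.

(** * Reading the parameter *)

Definition read_bit : prog :=
  Ifte (#rN < #rPow) Nop
    (rBit <- Inp #rPtr ;;
     Ifte (#rBit == $2) Nop
       (rK <- #rK + #rBit * #rPow ;; rPow <- #rPow * $2 ;; rPtr <- #rPtr + $1)).

(* A parameter of at least [n] need not fit into a word, and is replaced by [n]
   unless its digits end early. *)
Definition read_parameter : prog :=
  rK <- $0 ;; rPow <- $1 ;; rPtr <- #rN * #rN + $1 ;;
  For rBitIdx (#rN + $1) read_bit ;;
  rBit <- Inp #rPtr ;;
  Ifte (#rBit == $2) Nop (rK <- #rN).

Definition fvs_prog : prog :=
  rN <- Inp $0 ;; read_parameter ;; Ifte (#rK < #rN) compression (rAnswer <- $1).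

Definition fvs_program : cmd := Seq (compile fvs_prog) (Write (reg_addr rAnswer)).

Lemma modn_pow2S k j : k %% 2 ^ j.+1 = k %% 2 ^ j + (k %/ 2 ^ j %% 2) * 2 ^ j.
Proof.
rewrite expnS modn_divl -(modn_dvdm k (dvdn_mull 2 (dvdnn (2 ^ j)))) addnC.
exact: divn_eq.
Qed.

Section ReadParameter.
Variables (w cap G : nat) (inp : seq nat) (n k : nat).
Hypothesis G_ge : 1000 * (n.+1 * n.+1 * n.+1) <= G.
Hypothesis ok : adequate w cap G inp.
Local Notation len := (up_log 2 k.+1).
Hypothesis inp_digit : forall j, j < len -> nth 0 inp (n * n + 1 + j) = k %/ 2 ^ j %% 2.
Hypothesis inp_end : nth 0 inp (n * n + 1 + len) = 2.
Local Notation wp := (wp w cap G inp).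

Local Notation assignP := (wp_assign ok).
Local Notation ifteP := (wp_ifte ok).
Local Notation thenP := (wp_then ok).
Local Notation callP := (wp_conseq ok).
Local Notation nopP := (wp_nop ok).
Local Notation forP := (wp_for ok).

Let n_le_G : 1000 * n.+1 <= G := G_ge_linear G_ge.
Let sqr_le_G : 1000 * (n.+1 * n.+1) <= G := G_ge_sqr G_ge.

Lemma inp_is_end j : j <= len -> (nth 0 inp (n * n + 1 + j) == 2) = (j == len).
Proof.
rewrite leq_eqVlt => /orP[/eqP ->|jl]; first by rewrite inp_end !eqxx.
by rewrite inp_digit // (ltn_eqF jl) modn2; case: odd.
Qed.

Lemma pow2_le_param j : j < len -> 2 ^ j <= k.
Proof.
move=> jl; have k0 : 1 < k.+1 by case: (k) jl => //; rewrite up_log1.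
have /andP[+ _] := up_log_bounds (isT : 1 < 2) k0.
rewrite ltnS; apply: leq_trans; rewrite leq_pexp2l //.
by rewrite -ltnS prednK // (leq_ltn_trans _ jl).
Qed.

Definition bits_read j st : Prop :=
  [/\ reg st rN = n, reg st rPow = 2 ^ j, reg st rPtr = n * n + 1 + j,
      reg st rK = k %% 2 ^ j & (2 ^ j <= n.*2.+1) && (j <= len)].

Definition next_bit j := if (n < 2 ^ j) || (j == len) then j else j.+1.

Lemma read_bit_spec j st : bits_read j st ->
  wp 0 read_bit (bits_read (next_bit j)) 10 st.
Proof.
move=> [rNE powE ptrE rKE /andP[pow_le jl]]; 
rewrite /next_bit; apply: ifteP => //=.
  by rewrite rNE powE; case: ltnP => // small _; apply: nopP; split; rewrite ?pow_le ?jl.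
rewrite rNE powE; case: ltnP => // pow_n _.
have jn : j < n by apply: leq_trans pow_n; apply: ltn_expl.
apply: thenP; apply: assignP => //=; rewrite ptrE.
apply: ifteP => //=; rewrite inp_is_end //.
  by case: (j =P len) => // _ _; apply: nopP; split; rewrite /= ?pow_le ?jl.
case: (j =P len) => // /eqP j_len _; have {j_len} lt_len : j < len by rewrite ltn_neqAle j_len.
have bit_lt : k %/ 2 ^ j %% 2 < 2 by rewrite ltn_mod.
have bit_pow : k %/ 2 ^ j %% 2 * 2 ^ j <= 2 ^ j.
  by case: (_ %% 2) bit_lt => [|[|//]] _; rewrite ?mul1n.
rewrite inp_digit //.
apply: thenP; apply: assignP; rewrite //= rKE powE; first by do !split=> //; lia.
rewrite -modn_pow2S; apply: thenP; apply: assignP; rewrite //= powE; first by do !split=> //; lia.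
apply: assignP; rewrite //= ptrE; first by do !split=> //; lia.
split; rewrite //= ?expnSr ?addnS ?addn0 //.
by rewrite lt_len andbT; lia.
Qed.

Lemma iter_next_bit m : let j := iter m next_bit 0 in (n < 2 ^ j) || (j == len) || (j == m).
Proof.
elim: m => [|m IHm]; first by rewrite /= orbT.
rewrite iterS; move: (iter m next_bit 0) IHm => j; rewrite /next_bit.
by case: ifP => [-> //|_] /= /eqP ->; rewrite eqxx orbT.
Qed.

Lemma read_parameter_spec st : reg st rN = n ->
  wp 0 read_parameter (fun st' => minn (reg st' rK) n = minn k n) 25 st.
Proof.
move=> rNE; 
apply: thenP; apply: assignP => //; apply: thenP; apply: assignP => //.
apply: thenP; apply: assignP; rewrite //= rNE; first by do !split=> //; lia.
apply: thenP.
apply: (forP (N := n.+1) (y0 := 0) (f := fun _ => next_bit) (R := fun _ => bits_read)) => //.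
- by rewrite /= /fits_word /= rNE; split=> //; lia.
- by rewrite /= rNE addn1.
- lia.
- by split; rewrite //= ?modn1 ?addn0 //; lia.
- move=> c j st1 _ un read_j; apply: callP (@read_bit_spec j _ _) _ _ _ => //.
move=> st1 un1; rewrite foldr_iter size_iota => -[rNE1 _ ptrE rKE /andP[_ j_len]].
have stop := iter_next_bit n.+1; set j := iter _ _ _ in stop ptrE rKE j_len.
apply: thenP; apply: assignP; rewrite //= ptrE.
apply: ifteP; rewrite //= inp_is_end // => at_end.
  have jE : j = len by case: (j =P len) at_end.
  by apply: nopP; rewrite /= rKE jE modn_small // up_logP.
have lt_len : j < len by rewrite ltn_neqAle j_len andbT; case: (j == len) at_end.
have n_lt : n < 2 ^ j.
  case/orP: stop => [/orP[//|]|/eqP ->]; first by rewrite (ltn_eqF lt_len).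
  by apply: leq_trans (ltn_expl _ (isT : 1 < 2)); rewrite ltnS.
apply: assignP; rewrite //= rNE1 minnn; apply/esym/minn_idPr.
exact: leq_trans (ltnW n_lt) (pow2_le_param lt_len).
Qed.

End ReadParameter.

Lemma nth_allpairs (A B C : Type) (f : A -> B -> C) a0 b0 c0 (r : seq A) (t : seq B) i j :
  i < size r -> j < size t ->
  nth c0 [seq f x y | x <- r, y <- t] (i * size t + j) = f (nth a0 r i) (nth b0 t j).
Proof.
move=> + jt; elim: r i => //= x r IHr [|i] ir.
  by rewrite nth_cat size_map jt (nth_map b0).
by rewrite nth_cat size_map mulSn -addnA ltnNge leq_addr /= addKn IHr.
Qed.

Section Encoding.
Variables (n k : nat) (e : rel 'I_n).

Lemma size_adjacency : size [seq nat_of_bool (e u v) | u <- enum 'I_n, v <- enum 'I_n] = n * n.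
Proof. by rewrite size_allpairs !size_enum_ord. Qed.

Lemma nth_encode_adj (u v : 'I_n) : nth 0 (encode e k) (1 + (u * n + v)) = e u v.
Proof.
rewrite /encode add1n /= nth_cat size_adjacency row_major_lt.
have := @nth_allpairs _ _ _ (fun u v => nat_of_bool (e u v)) u v 0 (enum 'I_n) (enum 'I_n) u v.
by rewrite !size_enum_ord !nth_ord_enum => ->.
Qed.

Lemma nth_encode_digits j : nth 0 (encode e k) (n * n + 1 + j) = nth 0 (rcons (digits k) 2) j.
Proof. by rewrite /encode addn1 addSn /= nth_cat size_adjacency ltnNge leq_addr /= addKn. Qed.

Lemma nth_encode_digit j : j < up_log 2 k.+1 ->
  nth 0 (encode e k) (n * n + 1 + j) = k %/ 2 ^ j %% 2.
Proof. by move=> jl; rewrite nth_encode_digits nth_rcons size_mkseq jl nth_mkseq. Qed.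

Lemma nth_encode_end : nth 0 (encode e k) (n * n + 1 + up_log 2 k.+1) = 2.
Proof. by rewrite nth_encode_digits nth_rcons size_mkseq ltnn eqxx. Qed.

Lemma encode_le j : nth 0 (encode e k) j <= maxn 2 n.
Proof.
have [lt|ge] := ltnP j (size (encode e k)); last by rewrite nth_default.
suff /allP : all (fun x => x <= maxn 2 n) (encode e k) by apply; apply: mem_nth.
rewrite /= leq_maxr /= all_cat all_rcons; apply/and3P; split; last first.
- by apply/allP => x /mapP[q _ ->]; rewrite modn2 leq_max; case: odd.
- by rewrite leq_max.
- by apply/allP => x /allpairsP[[u v] /= [_ _ ->]]; rewrite leq_max; case: (e u v).
Qed.

End Encoding.

(** * Correctness and resource bounds *)

Lemma feedback_vertex_setE (T : finType) (e : rel T) k :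
  feedback_vertex_set e k <-> exists S : {set T}, #|S| <= k /\ acyclic e (~: S).
Proof. by split=> -[S [cS forS]]; exists S; split=> //; apply/forest_del_vertices. Qed.

Lemma feedback_vertex_set_large n k (e : rel 'I_n) : n <= k -> feedback_vertex_set e k.
Proof.
move=> nk; apply/feedback_vertex_setE; exists setT.
by rewrite cardsT card_ord setCT; split=> //; apply: acyclic0.
Qed.

Lemma answers_iff (P P' : Prop) st : (P <-> P') -> answers P st -> answers P' st.
Proof. by move=> PP' [ans ansE ansP]; exists ans => //; apply: iff_trans PP'. Qed.

Definition array_size n k : nat := if k < n then k.*2.+2 else 0.

Lemma adequate_encode w G n k (e : rel 'I_n) : 1000 * (n.+1 * n.+1 * n.+1) <= G -> G <= 2 ^ w ->
  adequate w (array_size n k) G (encode e k).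
Proof.
move=> G_ge G_le; have n_le_G := G_ge_linear G_ge; split=> //.
- exact: G_ge1000 G_ge.
- by rewrite /words /array_size /stack /regs; case: ifP; lia.
- by move=> j; apply: leq_ltn_trans (encode_le k e j) (leq_trans _ G_le); lia.
Qed.

Lemma fvs_prog_spec w G n k (e : rel 'I_n) :
  1000 * (n.+1 * n.+1 * n.+1) <= G -> G <= 2 ^ w -> symmetric e -> irreflexive e ->
  wp w (array_size n k) G (encode e k) k.+1 fvs_prog (answers (feedback_vertex_set e k)) 145 state0.
Proof.
move=> G_ge G_le e_sym e_irr; have ok := adequate_encode k e G_ge G_le.
apply: (wp_then ok); apply: (wp_assign ok) => //=; apply: (wp_then ok).
have digitsE := @nth_encode_digit n k e; have endE := nth_encode_end k e.
apply: (wp_conseq ok (read_parameter_spec G_ge ok digitsE endE _)) => //.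
move=> st un min_k; have rNE : reg st rN = n by state_simpl.
have arrE j : arr st aRoots j = 0 by state_simpl.
apply: (wp_ifte ok); rewrite //= rNE => rK_n.
  have {}rK_n : reg st rK < n by case: (_ < n) rK_n.
  have rKE : reg st rK = k by move: min_k; rewrite /minn rK_n; case: ltnP; lia.
  move: ok; rewrite rKE in rK_n; rewrite /array_size rK_n => ok.
  case: n e e_sym e_irr G_ge ok {min_k un digitsE endE} rNE rK_n => // n' e.
  move=> e_sym e_irr G_ge ok rNE _.
  have adjE := nth_encode_adj k e.
  apply: (wp_conseq ok (compression_spec G_ge ok adjE e_sym e_irr rNE rKE _)) => //.
    by move=> j _; rewrite arrE nth_nil.
  by move=> st' _; apply: answers_iff; apply: iff_sym; apply: feedback_vertex_setE.
apply: (wp_assign ok) => //=; exists true => //; split=> // _.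
apply: feedback_vertex_set_large; move: min_k rK_n; rewrite /minn; do 2 case: ltnP => //; lia.
Qed.

Lemma maxn2_le_pow n : maxn 2 n <= 2 ^ (2 * log2 n).
Proof.
apply: leq_trans (ltnW (trunc_log_ltn _ (isT : 1 < 2))) _; rewrite leq_pexp2l //.
have : 0 < log2 n by rewrite trunc_log_gt0 /= leq_maxl.
by rewrite -/(log2 n); lia.
Qed.

Lemma cube_le_pow n : 1000 * (n.+1 * n.+1 * n.+1) <= maxn 2 n ^ 16.
Proof.
have two_le : 2 <= maxn 2 n by apply: leq_maxl.
have n1_le : n.+1 <= maxn 2 n ^ 2 by rewrite expnS expn1; nia.
apply: (@leq_trans (2 ^ 10 * (maxn 2 n ^ 2 * maxn 2 n ^ 2 * maxn 2 n ^ 2))).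
  by rewrite !leq_mul.
by rewrite -!expnD [leqRHS](expnD _ 10 6) leq_mul2r leq_exp2r // two_le orbT.
Qed.

Lemma space_bound n k l : words (array_size n k) * (32 * l) <= 88 * 32 * (maxn 1 k * l).
Proof.
rewrite !mulnA leq_mul2r; apply/orP; right.
have := leq_maxl 1 k; have := leq_maxr 1 k; rewrite /words /array_size /stack /regs.
by case: ifP => _; lia.
Qed.

Lemma time_bound G N k t : 1000 <= G -> G <= N ^ 16 ->
  t <= (5 ^ k.+1 * G ^ 145).+1 -> t <= 5 ^ k * N ^ (16 * 146).
Proof.
move=> G1 G_N t_le; apply: (@leq_trans (5 ^ k * G ^ 146)); last first.
  by rewrite leq_mul2l expnM leq_exp2r // G_N orbT.
rewrite (expnSr G 145) mulnA; move: t_le; rewrite expnS -mulnA.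
have : 0 < 5 ^ k * G ^ 145 by rewrite muln_gt0 !expn_gt0; lia.
move: (5 ^ k * G ^ 145) => T T_gt0 t_le; have := leq_mul (leqnn T) G1; lia.
Qed.

Theorem theorem6 :
  exists (p : cmd) (a b d : nat),
    forall (n k : nat) (e : rel 'I_n),
      symmetric e -> irreflexive e ->
      exists (s t : nat) (ans : bool),
        [/\ runs (a * log2 n) s p (encode e k) [:: nat_of_bool ans] t,
            ans <-> feedback_vertex_set e k,
            s * (a * log2 n) <= b * (maxn 1 k * log2 n)
          & t <= 5 ^ k * maxn 2 n ^ d].
Proof.
exists fvs_program, 32, (88 * 32), (16 * 146) => n k e e_sym e_irr.
set G := 1000 * (n.+1 * n.+1 * n.+1); have G_ge : G <= G by [].
have G_pow : G <= maxn 2 n ^ 16 := cube_le_pow n.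
have G_le : G <= 2 ^ (32 * log2 n).
  apply: leq_trans G_pow _; rewrite -[32]/(2 * 16) mulnAC expnM leq_exp2r //.
  exact: maxn2_le_pow.
have correct := fvs_prog_spec (k := k) G_ge G_le e_sym e_irr.
have ok := adequate_encode k e G_ge G_le.
have [//|st [ans ansE ansP] [t t_le run]] := wp_exec ok (r := rAnswer) _ correct.
rewrite ansE in run; exists (words (array_size n k)), t, ans; split=> //.
- exact: space_bound.
- exact: time_bound (G_ge1000 G_ge) G_pow t_le.
Qed.
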